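(* Let $\Delta$ be the open unit disc in $\mathbb{C}$, let $(M_n)$ be a non-analytic weight sequence, and let $\phi$ be an analytic self-map of $\overline\Delta$. Then $\phi$ induces a compact endomorphism of $D(\overline\Delta,M)$ if and only if $$\overline\Delta=\{z\in\overline\Delta:|\phi'(z)|<1\}\cup\phi^{-1}(\Delta).$$
   Context: For a perfect compact plane set $X$, $f:X\to\mathbb{C}$ is complex-differentiable at $a\in X$ if $f'(a)=\lim_{z\to a,\ z\in X}\frac{f(z)-f(a)}{z-a}$ exists; $f^{(n)}$ denotes the $n$-th complex derivative in this sense (with $f^{(0)}=f$), and $D^\infty(X)$ is the set of infinitely complex-differentiable functions on $X$. A weight sequence is a sequence $(M_n)_{n\ge 0}$ of positive numbers with $M_0=1$ and $\frac{M_{n+m}}{M_nM_m}\ge\binom{n+m}{n}$ for all non-negative integers $m,n$; it is non-analytic if $\lim_{n\to\infty}(n!/M_n)^{1/n}=0$. The Dales-Davie algebra is $$D(X,M)=\Big\{f\in D^\infty(X):\ \|f\|_D=\sum_{n=0}^\infty\frac{\|f^{(n)}\|_\infty}{M_n}<\infty\Big\},$$ where $\|\cdot\|_\infty$ is the supremum norm on $X$. A map $\phi\in D^\infty(X)$ is called analytic if $\sup_{k\ge1}\left(\|\phi^{(k)}\|_\infty/k!\right)^{1/k}<\infty$; an analytic self-map of $X$ is an analytic $\phi$ with $\phi(X)\subseteq X$. A self-map $\phi$ of $X$ induces an endomorphism of $D(X,M)$ if $f\circ\phi\in D(X,M)$ for every $f\in D(X,M)$; the induced endomorphism is $f\mapsto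 f\circ\phi$, and it is called compact if it is a compact linear operator. *)

(* Defs.v *)
From HB Require Import structures.
From mathcomp Require Import all_boot all_order all_algebra.
From mathcomp Require Import all_classical all_reals all_analysis complex.
Import Order.TTheory GRing.Theory Num.Theory.
Import numFieldNormedType.Exports.

Set Implicit Arguments.
Unset Strict Implicit.
Unset Printing Implicit Defensive.

Local Open Scope classical_set_scope.
Local Open Scope ring_scope.

(* The library equips an abstract numFieldType with its topology; the concrete
   field R[i] needs the same structure, copied from the regular module R[i]^o. *)
HB.instance Definition _ (R : realType) := GRing.ComAlgebra.copy R[i] R[i]^o.
HB.instance Definition _ (R : realType) := Vector.copy R[i] R[i]^o.
HB.instance Definition _ (R : realType) := NormedModule.copy R[i] R[i]^o.

(* The empty set, which is perfect for [perfect_set], is excluded. *)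
Record planeSet (R : realType) := PlaneSet {
  planeSet_set :> set R[i];
  planeSet_neq0 : planeSet_set !=set0;
  planeSet_compact : compact planeSet_set;
  planeSet_perfect : perfect_set planeSet_set }.

(* A set X : set R[i] coerces to the type of its points, with the subspace
   topology, so that a^' below is the filter of punctured neighbourhoods of a
   within X. As [lim] is total, [cderiv f a] is meaningful only under
   [cdifferentiable f a]. *)
Section Deriv.
Context {R : realType} {X : set R[i]}.
Implicit Types (f : X -> R[i]) (a : X).

Definition diff_quotient f a (z : X) : R[i] :=
  (f z - f a) / (set_val z - set_val a).

Definition cdifferentiable f a := cvg (diff_quotient f a @ a^').

Definition cderiv f a : R[i] := lim (diff_quotient f a @ a^').

Definition cderivn n f : X -> R[i] := iter n cderiv f.

Definition Dinfty : set (X -> R[i]) :=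
  [set f | forall n a, cdifferentiable (cderivn n f) a].

(* Extended-real valued, hence defined for unbounded f; Re only converts the
   norm, a nonnegative real element of R[i], to R. *)
Definition supnorm f : \bar R :=
  ereal_sup [set (complex.Re `|f z|)%:E | z in [set: X]].
End Deriv.

Section DerivTheory.
Context {R : realType} {X : planeSet R}.
Implicit Types (f g : X -> R[i]) (a : X) (c : R[i]).

Lemma dnbhs_planeSet_proper a : ProperFilter a^'.
Proof.
apply: Build_ProperFilter_ex.
move=> P [Q [ [V oV <-] Va] QP].
have : limit_point (X : set R[i]) (set_val a).
  by have [_ ->] := planeSet_perfect X; rewrite set_valE; case: a {Va QP} => /= x /set_mem.
move=> /(_ V (open_nbhs_nbhs (conj oV Va)))[y [ya /mem_set Xy Vy]].
exists (exist _ y Xy); apply: QP => //.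
Qed.

Lemma diff_quotientP c f g a :
  diff_quotient (c *: f + g) a = c *: diff_quotient f a + diff_quotient g a.
Proof.
apply/funext => z.
rewrite -[LHS]/((c * f z + g z - (c * f a + g a)) / (set_val z - set_val a)).
rewrite -[RHS]/(c * ((f z - f a) / (set_val z - set_val a)) +
  (g z - g a) / (set_val z - set_val a)).
by rewrite mulrA -mulrDl mulrBr opprD addrACA.
Qed.

Lemma cvg_diff_quotientP c f g a : cdifferentiable f a -> cdifferentiable g a ->
  diff_quotient (c *: f + g) a @ a^' --> c *: cderiv f a + cderiv g a.
Proof.
have := dnbhs_planeSet_proper a => PF df dg.
by rewrite diff_quotientP; apply: cvgD; [apply: cvgZr; exact: df|exact: dg].
Qed.

Lemma cderivP c f g a : cdifferentiable f a -> cdifferentiable g a ->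
  cderiv (c *: f + g) a = c *: cderiv f a + cderiv g a.
Proof.
have := dnbhs_planeSet_proper a => PF df dg.
have := cvg_diff_quotientP (c := c) df dg.
by move/cvg_lim; apply; exact: norm_hausdorff.
Qed.

Lemma cderivnP c f g n : Dinfty f -> Dinfty g ->
  cderivn n (c *: f + g) = c *: cderivn n f + cderivn n g.
Proof.
move=> df dg; elim: n => [//|n IHn]; rewrite /cderivn !iterS.
by apply/funext => a; rewrite -!/(cderivn n _) IHn cderivP; [|exact: df|exact: dg].
Qed.

Lemma DinftyP c f g : Dinfty f -> Dinfty g -> Dinfty (c *: f + g).
Proof.
move=> df dg n a; rewrite cderivnP//; apply/cvg_ex; eexists.
by apply: cvg_diff_quotientP; [exact: df|exact: dg].
Qed.

Lemma cderivn0 n : cderivn n (0 : X -> R[i]) = 0.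
Proof.
elim: n => [//|n IHn]; rewrite /cderivn iterS -/(cderivn n _) IHn.
apply/funext => a; have := dnbhs_planeSet_proper a => PF.
rewrite /cderiv (_ : diff_quotient _ _ = cst 0); first exact: lim_cst.
by apply/funext => z; rewrite /diff_quotient subrr mul0r.
Qed.

Lemma Dinfty0 : Dinfty (0 : X -> R[i]).
Proof.
move=> n a; have := dnbhs_planeSet_proper a => PF.
rewrite cderivn0 /cdifferentiable (_ : diff_quotient _ _ = cst 0); first exact: is_cvg_cst.
by apply/funext => z; rewrite /diff_quotient subrr mul0r.
Qed.

Lemma ReK (z : R[i]) : (complex.Re `|z|)%:C%C = `|z|.
Proof. by rewrite normc_def. Qed.

Lemma supnorm_ub f a : ((complex.Re `|f a|)%:E <= supnorm f)%E.
Proof. by apply: ereal_sup_ubound; exists a. Qed.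

Lemma supnorm_ge0 f : (0 <= supnorm f)%E.
Proof.
have [x /mem_set Xx] := planeSet_neq0 X.
apply: le_trans (supnorm_ub f (exist _ x Xx)).
by rewrite lee_fin normc_def /= sqrtr_ge0.
Qed.

Lemma supnorm_le f (r : \bar R) :
  (forall a, ((complex.Re `|f a|)%:E <= r)%E) -> (supnorm f <= r)%E.
Proof. by move=> H; apply: ge_ereal_sup => _ [a _ <-]. Qed.

Lemma supnorm0 : supnorm (0 : X -> R[i]) = 0%E.
Proof.
apply/eqP; rewrite eq_le supnorm_ge0 andbT; apply: supnorm_le => a.
by rewrite [X in `|X|](_ : _ = 0)// normr0.
Qed.

Lemma supnormD f g : (supnorm (f + g)%R <= supnorm f + supnorm g)%E.
Proof.
apply: supnorm_le => a.
apply: le_trans (leeD (supnorm_ub f a) (supnorm_ub g a)).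
by rewrite -EFinD lee_fin -lecR rmorphD /= !ReK ler_normD.
Qed.

Lemma supnormZ_le c f : (supnorm (c *: f)%R <= (complex.Re `|c|)%:E * supnorm f)%E.
Proof.
apply: supnorm_le => a.
have c0 : 0 <= complex.Re `|c| by rewrite normc_def /= sqrtr_ge0.
apply: le_trans (lee_wpmul2l _ (supnorm_ub f a)); last by rewrite lee_fin.
by rewrite -EFinM lee_fin -lecR rmorphM /= !ReK normrM.
Qed.

End DerivTheory.

Record weightSeq (R : realType) := WeightSeq {
  weightSeq_seq :> nat -> R;
  weightSeq_gt0 : forall n, 0 < weightSeq_seq n;
  weightSeq_0 : weightSeq_seq 0%N = 1;
  weightSeq_bin : forall m n,
    'C(n + m, n)%:R <= weightSeq_seq (n + m)%N / (weightSeq_seq n * weightSeq_seq m) }.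

Definition non_analytic (R : realType) (M : weightSeq R) :=
  (n`!%:R / M n) `^ n%:R^-1 @[n --> \oo] --> (0 : R).

Section DalesDavieNorm.
Context {R : realType} {X : planeSet R} (M : weightSeq R).
Implicit Types (f g : X -> R[i]) (c : R[i]).

Definition ddnorm f : \bar R :=
  (\sum_(0 <= n <oo) supnorm (cderivn n f) * ((M n)^-1)%:E)%E.

(* Every supremum norm is finite as soon as the sum is. *)
Definition ddmem : {pred X -> R[i]} :=
  [pred f | `[< Dinfty f /\ (ddnorm f < +oo)%E >]].

Lemma ddnorm_term_ge0 f n : (0 <= supnorm (cderivn n f) * ((M n)^-1)%:E)%E.
Proof.
by apply: mule_ge0; [exact: supnorm_ge0|rewrite lee_fin invr_ge0 ltW// weightSeq_gt0].
Qed.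

Lemma ddnorm_ge0 f : (0 <= ddnorm f)%E.
Proof. by apply: nneseries_ge0 => n _ _; exact: ddnorm_term_ge0. Qed.

Lemma ddnorm0 : ddnorm (0 : X -> R[i]) = 0%E.
Proof.
by apply: eseries0 => n _ _; rewrite cderivn0 supnorm0 mul0e.
Qed.

Lemma ddnormP c f g : Dinfty f -> Dinfty g ->
  (ddnorm (c *: f + g)%R <= (complex.Re `|c|)%:E * ddnorm f + ddnorm g)%E.
Proof.
move=> df dg; rewrite /ddnorm.
have c0 : (0 <= (complex.Re `|c|)%:E :> \bar R)%E.
  by rewrite lee_fin normc_def /= sqrtr_ge0.
rewrite -nneseriesZl; last by move=> n _; exact: ddnorm_term_ge0.
rewrite -nneseriesD; first last.
- by move=> n _ _; exact: ddnorm_term_ge0.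
- by move=> n _ _; apply: mule_ge0 => //; exact: ddnorm_term_ge0.
apply: lee_nneseries => n; first by move=> _ _; exact: ddnorm_term_ge0.
move=> _; rewrite cderivnP// muleA -ge0_muleDl; [|exact: mule_ge0 (supnorm_ge0 _)|exact: supnorm_ge0].
apply: lee_wpmul2r; first by rewrite lee_fin invr_ge0 ltW// weightSeq_gt0.
apply: le_trans (supnormD _ _) _.
by apply: leeD => //; exact: supnormZ_le.
Qed.

Lemma ddmem_submod_closed : submod_closed ddmem.
Proof.
split; first by apply/asboolP; split; [exact: Dinfty0|rewrite ddnorm0].
move=> c f g /asboolP[df nf] /asboolP[dg ng]; apply/asboolP.
split; first exact: DinftyP.
apply: le_lt_trans (ddnormP _ df dg) _.
rewrite lte_add_pinfty// lte_mul_pinfty//.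
by rewrite lee_fin normc_def /= sqrtr_ge0.
Qed.

HB.instance Definition _ := GRing.isSubmodClosed.Build R[i] (X -> R[i]) ddmem
  ddmem_submod_closed.

End DalesDavieNorm.
Arguments ddmem {R} X M.

Record dalesDavie (R : realType) (X : planeSet R) (M : weightSeq R) := DalesDavie {
  dalesDavie_fun :> X -> R[i];
  dalesDavieP : dalesDavie_fun \in ddmem X M }.

Section DalesDavie.
Context {R : realType} (X : planeSet R) (M : weightSeq R).

HB.instance Definition _ := [isSub of dalesDavie X M for @dalesDavie_fun R X M].
HB.instance Definition _ := [Choice of dalesDavie X M by <:].
HB.instance Definition _ := [SubChoice_isSubLmodule of dalesDavie X M by <:].

Definition dalesDavie_norm (f : dalesDavie X M) : R[i] := (fine (ddnorm M f))%:C%C.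

Lemma dalesDavie_Dinfty (f : dalesDavie X M) : Dinfty f.
Proof. by have /asboolP[] := dalesDavieP f. Qed.

Arguments dalesDavie_Dinfty : clear implicits.

Lemma dalesDavie_fineK (f : dalesDavie X M) : (fine (ddnorm M f))%:E = ddnorm M f.
Proof.
have /asboolP[_ nf] := dalesDavieP f.
by rewrite fineK// ge0_fin_numE// ddnorm_ge0.
Qed.

Lemma dalesDavie_normP (c : R[i]) (f g : dalesDavie X M) :
  dalesDavie_norm (c *: f + g) <= `|c| * dalesDavie_norm f + dalesDavie_norm g.
Proof.
rewrite /dalesDavie_norm -(ReK c) -rmorphM -rmorphD /= lecR.
rewrite -lee_fin EFinD EFinM (dalesDavie_fineK f) (dalesDavie_fineK g).
rewrite (dalesDavie_fineK (c *: f + g)).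
exact: (@ddnormP _ _ M c _ _ (dalesDavie_Dinfty f) (dalesDavie_Dinfty g)).
Qed.

Lemma dalesDavie_norm0 : dalesDavie_norm 0 = 0.
Proof. by rewrite /dalesDavie_norm [X in fine X]ddnorm0. Qed.

Lemma dalesDavie_normD (f g : dalesDavie X M) :
  dalesDavie_norm (f + g) <= dalesDavie_norm f + dalesDavie_norm g.
Proof.
by have := dalesDavie_normP 1 f g; rewrite scale1r normr1 mul1r.
Qed.

Lemma dalesDavie_normZ (c : R[i]) (f : dalesDavie X M) :
  dalesDavie_norm (c *: f) = `|c| * dalesDavie_norm f.
Proof.
have le_normZ b (g : dalesDavie X M) : dalesDavie_norm (b *: g) <= `|b| * dalesDavie_norm g.
  by have := dalesDavie_normP b g 0; rewrite !addr0 dalesDavie_norm0 addr0.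
have [->|c0] := eqVneq c 0; first by rewrite scale0r normr0 mul0r dalesDavie_norm0.
apply/eqP; rewrite eq_le le_normZ/= -ler_pdivlMl ?normr_gt0// -normfV.
by apply: le_trans (le_normZ _ _); rewrite scalerA mulVf// scale1r.
Qed.

Lemma dalesDavie_norm_eq0 (f : dalesDavie X M) : dalesDavie_norm f = 0 -> f = 0.
Proof.
move=> /eqP; rewrite /dalesDavie_norm -[0]/((0 : R)%:C)%C (inj_eq (@complexI _)) => /eqP f0.
have {}f0 : ddnorm M f = 0%E by rewrite -dalesDavie_fineK f0.
apply/val_inj/funext => a /=.
have : (supnorm f * ((M 0%N)^-1)%:E <= ddnorm M f)%E.
  have := @nneseries_lim_ge R _ xpredT 0%N 1%N (fun n _ _ => ddnorm_term_ge0 M f n).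
  by rewrite big_nat1.
rewrite f0 weightSeq_0 invr1 mule1 => f_le0.
have := le_trans (supnorm_ub f a) f_le0; rewrite lee_fin -lecR ReK normr_le0.
by move/eqP.
Qed.

HB.instance Definition _ := Lmodule_isNormed.Build R[i] (dalesDavie X M)
  dalesDavie_normD dalesDavie_normZ dalesDavie_norm_eq0.

End DalesDavie.

Definition compact_operator (K : numFieldType) (V W : normedModType K)
    (T : {linear V -> W}) :=
  forall B : set V, bounded_set B -> precompact (T @` B).

Section Endomorphism.
Context {R : realType} {X : planeSet R} (M : weightSeq R).

Definition induces_endomorphism (phi : X -> X) :=
  forall f : X -> R[i], f \in ddmem X M -> f \o phi \in ddmem X M.

Definition induced_endomorphism (phi : X -> X) (phiD : induces_endomorphism phi)
    (f : dalesDavie X M) : dalesDavie X M :=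
  DalesDavie (phiD _ (dalesDavieP f)).

Lemma induced_endomorphism_is_linear phi (phiD : induces_endomorphism phi) :
  linear (induced_endomorphism phiD).
Proof. by move=> c f g; exact: val_inj. Qed.

HB.instance Definition _ phi (phiD : induces_endomorphism phi) :=
  GRing.isLinear.Build R[i] (dalesDavie X M) (dalesDavie X M) _
    (induced_endomorphism phiD) (induced_endomorphism_is_linear phiD).

End Endomorphism.

Section Analytic.
Context {R : realType} {X : planeSet R}.

Definition analytic (f : X -> R[i]) :=
  Dinfty f /\
  (ereal_sup [set (supnorm (cderivn k f) * (k`!%:R^-1)%:E) `^ k%:R^-1 |
              k in [set k | (0 < k)%N]] < +oo)%E.

Definition analytic_selfmap (phi : X -> X) := analytic (set_val \o phi).

End Analytic.

Section Disc.
Context {R : realType}.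

Definition open_disc : set R[i] := [set z | `|z| < 1].

Definition disc_set : set R[i] := [set z | `|z| <= 1].

Lemma complex_ge0 (e : R[i]) : 0 <= e -> e = (complex.Re e)%:C%C.
Proof. by case: e => x y; rewrite lecE /= => /andP[/eqP -> _]. Qed.

Lemma disc_set_closed : closed disc_set.
Proof.
move=> z clz; rewrite /disc_set /=.
rewrite real_leNgt ?normr_real ?real1//; apply/negP => z1.
have /clz[w [w1]] : nbhs z (ball z (`|z| - 1)) by apply: nbhsx_ballx; rewrite subr_gt0.
rewrite -ball_normE /= => zw.
have := le_lt_trans (lerB_dist z w) zw.
by rewrite ltrD2l ltrN2 => /lt_le_trans/(_ w1); rewrite ltxx.
Qed.

Lemma continuous_real_complex : continuous (fun x : R => x%:C%C : R[i]).
Proof.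
move=> x; apply/cvgrPdist_lt => e e0.
have {e0} [d d0 ->] : exists2 d : R, 0 < d & e = d%:C%C.
  have eE := complex_ge0 (ltW e0).
  by exists (complex.Re e) => //; rewrite eE ltcR in e0.
near=> y; rewrite -rmorphB /= normc_def /= expr0n/= addr0 sqrtr_sqr ltcR.
by near: y; exact: cvgr_dist_lt.
Unshelve. all: by end_near. Qed.

Lemma disc_set_compact : compact disc_set.
Proof.
pose h (p : R * R) : R[i] := p.1%:C%C + 'i%C * p.2%:C%C.
have hc : continuous h.
  move=> p; apply: cvgD.
    by apply: continuous_comp; [exact: cvg_fst|exact: continuous_real_complex].
  apply: cvgM; first exact: cvg_cst.
  by apply: continuous_comp; [exact: cvg_snd|exact: continuous_real_complex].
have := continuous_compact (continuous_subspaceT hc)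
  (compact_setX (@segment_compact R (-1) 1) (@segment_compact R (-1) 1)).
move=> cK; apply: (subclosed_compact disc_set_closed cK).
move=> [x y]; rewrite /disc_set /= normc_def lecR /= => xy1.
have s1 : x ^+ 2 + y ^+ 2 <= 1.
  by rewrite -[leRHS](expr1n _ 2) -(@ler_sqrt _ _ (1 ^+ 2))// ?expr1n// sqrtr1.
exists (x, y); last first.
  by apply/eqP; rewrite eq_complex /= !(mul0r, mul1r, mulr0, subr0, add0r, addr0) !eqxx.
split; rewrite /= in_itv /= -ler_norml -(@expr_le1 _ 2)// real_normK ?num_real//.
  by apply: le_trans s1; rewrite lerDl sqr_ge0.
by apply: le_trans s1; rewrite lerDr sqr_ge0.
Qed.

Lemma disc_set_perfect : perfect_set disc_set.
Proof.
split; first exact: disc_set_closed.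
apply/seteqP; split => [z /subset_limit_point|z z1 U].
  exact: disc_set_closed.
rewrite -nbhs_ballE => -[e /= e0 eU].
pose t : R[i] := e / (1 + e) / 2.
have e1 : 0 < 1 + e by rewrite ltr_pwDl// ltW.
have t0 : 0 < t by rewrite !divr_gt0.
have te : t < e.
  rewrite /t -mulrA gtr_pMr// -invfM invf_lt1 ?mulr_gt0//.
  by rewrite mulrDl mul1r (lt_trans (_ : 1 < 2))// ?ltr1n// ltrDl mulr_gt0.
have t1 : t < 1.
  rewrite /t ltr_pdivrMr// mul1r (@lt_trans _ _ 1)// ?ltr1n//.
  by rewrite ltr_pdivrMr// mul1r ltrDr.
have [z0|z0] := eqVneq z 0.
  exists t; split; first by rewrite z0 gt_eqF.
    by rewrite /disc_set /= gtr0_norm// ltW.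
  by apply: eU; rewrite -ball_normE /= z0 sub0r normrN gtr0_norm.
exists ((1 - t) * z); split.
- by rewrite mulrBl mul1r -subr_eq0 addrAC subrr add0r oppr_eq0 mulf_neq0// gt_eqF.
- rewrite /disc_set /= normrM mulr_ile1// gtr0_norm ?subr_gt0//.
  by rewrite gerBl ltW.
- apply: eU; rewrite -ball_normE /= mulrBl mul1r opprB addrC subrK normrM gtr0_norm//.
  by apply: le_lt_trans te; rewrite ger_pMr.
Qed.

Lemma disc_set_neq0 : disc_set !=set0.
Proof. by exists 0; rewrite /disc_set /= normr0. Qed.

Definition closed_disc : planeSet R :=
  PlaneSet disc_set_neq0 disc_set_compact disc_set_perfect.

End Disc.
Arguments open_disc : clear implicits.
Arguments closed_disc : clear implicits.

(* Main.v *)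
Require Import Defs.
From mathcomp Require Import all_boot all_order all_algebra.
From mathcomp Require Import all_classical all_reals all_analysis complex.
From mathcomp Require Import ring lra.
Import Order.TTheory GRing.Theory Num.Theory.
Import numFieldNormedType.Exports.
Local Open Scope classical_set_scope.
Local Open Scope ring_scope.

Set Implicit Arguments.
Unset Strict Implicit.
Unset Printing Implicit Defensive.

(** Why the theorem holds.

    Sufficiency. By compactness there is d > 0 such that at every point of the
    disc either |phi| <= 1 - d or |phi'| <= 1 - d ([uniform_gap]). The
    derivatives of f o phi at a point are dominated by the coefficients of a
    composition of power series ([comp_majorant]), in which the Taylor
    coefficients of the analytic map phi are replaced by a geometric sequence.
    - Where |phi'| <= 1 - d, the submultiplicativity of n!/M_n splits the
      weight M_m of the outer derivative from the rest, and the non-analyticity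
      of M makes the contribution of the higher derivatives of phi as small as
      desired: the total is at most a constant times the sum of
      rho^m |f^(m)| / M_m with rho < 1 ([majorant_sum_contraction]).
    - Where |phi| <= 1 - d, Cauchy's estimate bounds f^(m) at the value of phi
      by m! |f| / d^m, so that |(f o phi)^(n)| is at most 2 n! |f| / e^n for some
      e > 0, which non-analytic weights sum ([majorant_sum_inner]).
    Together, the norm of f o phi is at most
      K * (sum over m of rho^m |f^(m)| / M_m),
    with rho < 1 ([composition_estimate]). This shows that phi induces an
    endomorphism, and also that it is compact. Indeed, along an ultrafilter on
    a ball of the algebra all derivatives converge, uniformly because they are
    equi-Lipschitz, to the derivatives of a function of the same ball; the
    factors rho^m make the tails uniformly small, so the images converge in
    norm, and the image of a closed ball is itself compact
    ([compact_image_ball]).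

    Cauchy's estimate ([cauchy_estimate]) comes from discrete circles. The
    averages of f(x + d s w^j) w^(-jk) over the N-th roots of unity w^j form a
    function A of s in the disc; summation by parts gives
    s A'(s) = k A(s) up to an error that vanishes as N grows, so that
    A(s)/s^k is nearly constant. At s = 1 it is bounded by |f|, and for small s
    Taylor's formula shows that it is close to d^k f^(k)(x)/k!.

    Necessity. Let |phi(z0)| = 1. If z0 is an interior point, a first-order
    expansion shows that phi'(z0) = 0 ([interior_derivative_eq0]). If
    |z0| = 1 and |phi'(z0)| >= 1, then for each n let f_n be a function of the
    unit ball vanishing to order n at phi(z0) whose n-th derivative there is
    at least half of the maximal one. For n < m the function
    (f_n - f_m) o phi vanishes to order n at z0, with n-th derivative
    f_n^(n)(phi(z0)) phi'(z0)^n. Since rotations preserve the norm, this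
    function has norm at least 1/2, and the images of the f_n have no
    cluster point ([boundary_derivative_lt1]). *)


(** * The modulus of complex numbers and limits in plane sets *)

Notation modc z := (ComplexField.Normc.normc z).

Section Modulus.
Context {R : realType}.
Implicit Types x y z : R[i].

Lemma normcE z : `|z| = (modc z)%:C%C. Proof. by []. Qed.

Lemma modc_ge0 z : 0 <= modc z.
Proof. by rewrite -lecR -normcE normr_ge0. Qed.

Lemma modcD x y : modc (x + y) <= modc x + modc y.
Proof. by rewrite -lecR rmorphD /= -!normcE ler_normD. Qed.

Lemma modcM x y : modc (x * y) = modc x * modc y.
Proof. exact: ComplexField.Normc.normcM. Qed.

Lemma modcN x : modc (- x) = modc x.
Proof. by apply: complexI; rewrite -!normcE normrN. Qed.

Lemma modcV x : modc x^-1 = (modc x)^-1.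
Proof. exact: ComplexField.Normc.normcV. Qed.

Lemma modcX x n : modc (x ^+ n) = modc x ^+ n.
Proof. by apply: complexI; rewrite -!normcE rmorphXn /= -!normcE normrX. Qed.

Lemma modc_dist x y : modc (x - y) = modc (y - x).
Proof. by rewrite -modcN opprB. Qed.

Lemma modc0 : modc (0 : R[i]) = 0. Proof. exact: ComplexField.Normc.normc0. Qed.

Lemma modc_eq0 z : (modc z == 0) = (z == 0).
Proof. by apply/eqP/eqP => [/ComplexField.Normc.eq0_normc|->]; rewrite ?modc0. Qed.

Lemma modc_gt0 z : (0 < modc z) = (z != 0).
Proof. by rewrite lt_def modc_eq0 modc_ge0 andbT. Qed.

Lemma modc_real (r : R) : modc (r%:C%C) = `|r|.
Proof. by rewrite /= expr0n /= addr0 sqrtr_sqr. Qed.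

Lemma modc_nat n : modc (n%:R : R[i]) = n%:R.
Proof. by rewrite -(rmorph_nat (real_complex R)) modc_real normr_nat. Qed.

Lemma modc_sum I (r : seq I) (P : pred I) (F : I -> R[i]) :
  modc (\sum_(i <- r | P i) F i) <= \sum_(i <- r | P i) modc (F i).
Proof.
elim/big_rec2: _ => [|i u v _ le_vu]; first by rewrite modc0.
by apply: le_trans (modcD _ _) _; rewrite lerD2l.
Qed.

Lemma lerB_modc x y : modc x - modc y <= modc (x - y).
Proof. by rewrite lerBlDr; apply: le_trans (modcD _ _); rewrite subrK. Qed.

Lemma Re_le_modc z : complex.Re z <= modc z.
Proof.
case: z => x y; rewrite /= (le_trans (ler_norm _))// -sqrtr_sqr ler_wsqrtr//.
by rewrite lerDl sqr_ge0.
Qed.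

Lemma open_discE z : open_disc R z = (modc z < 1) :> Prop.
Proof. by rewrite /open_disc /= normcE -[1]/(1%:C)%C ltcR. Qed.

Lemma disc_setE z : disc_set z = (modc z <= 1) :> Prop.
Proof. by rewrite /disc_set /= normcE -[1]/(1%:C)%C lecR. Qed.

(** The norm of R[i] takes its values in R[i]; with the modulus all estimates
    take place in the ordered field R. *)
Lemma cvg_modcP {T : Type} {F : set_system T} {FF : Filter F} (f : T -> R[i]) (l : R[i]) :
  f @ F --> l <-> forall e : R, 0 < e -> \forall x \near F, modc (f x - l) < e.
Proof.
split => [/cvgrPdist_lt fl e e0|fl].
  have /fl : (0 : R[i]) < e%:C%C by rewrite ltcR.
  by apply: filterS => x; rewrite normcE ltcR modc_dist.
apply/cvgrPdist_lt => e e0.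
have eE := complex_ge0 (ltW e0).
have : 0 < complex.Re e by rewrite -ltcR -eE.
move/fl; apply: filterS => x.
by rewrite eE normcE ltcR modc_dist.
Qed.

(* The limit laws over an abstract filter: with the type of values fixed, they
   apply without unfolding the topology of a subspace. *)
Lemma cvgcD {T : Type} {F : set_system T} {FF : Filter F} (f g : T -> R[i]) (l m : R[i]) :
  f x @[x --> F] --> l -> g x @[x --> F] --> m -> f x + g x @[x --> F] --> l + m.
Proof. exact: cvgD. Qed.

Lemma cvgcM {T : Type} {F : set_system T} {FF : Filter F} (f g : T -> R[i]) (l m : R[i]) :
  f x @[x --> F] --> l -> g x @[x --> F] --> m -> f x * g x @[x --> F] --> l * m.
Proof. exact: cvgM. Qed.

Lemma cvgcV {T : Type} {F : set_system T} {FF : Filter F} (f : T -> R[i]) (l : R[i]) :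
  l != 0 -> f x @[x --> F] --> l -> (f x)^-1 @[x --> F] --> l^-1.
Proof. exact: cvgV. Qed.

End Modulus.

Section SubspaceNbhs.
Context {R : realType} {X : set R[i]}.
Implicit Types (a : X) (P : X -> Prop).

Lemma near_planeP a P :
  (\forall z \near a, P z) <->
  exists2 d : R, 0 < d & forall z : X, modc (set_val z - set_val a) < d -> P z.
Proof.
split=> [[Q [[V oV <-] Va] QP]|[d d0 dP]].
  have /nbhs_ballP[e /= e0 eV] : nbhs (set_val a) V by exact: open_nbhs_nbhs.
  have eE := complex_ge0 (ltW e0).
  exists (complex.Re e) => [|z ze]; first by rewrite -ltcR -eE.
  apply: QP; apply: eV; rewrite -ball_normE /= eE.
  by rewrite normcE ltcR modc_dist.
have d0' : (0 : R[i]) < d%:C%C by rewrite ltcR.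
have [V [oV Va] VB] : exists2 V, open_nbhs (set_val a) V & V `<=` ball (set_val a) d%:C%C.
  by have := nbhsx_ballx (set_val a) _ d0'; rewrite nbhsE.
exists (set_val @^-1` V); split=> //; first by exists V.
move=> z /VB; rewrite -ball_normE /= normcE ltcR modc_dist.
exact: dP.
Qed.

(** The neighbourhood filter of [a] within the set, with real radii instead of
    open sets. *)
Definition plane_nbhs a : set_system X := [set P | exists2 d : R, 0 < d &
  forall z : X, modc (set_val z - set_val a) < d -> P z].

#[export] Instance plane_nbhs_filter a : Filter (plane_nbhs a).
Proof.
split=> [|P Q [d d0 dP] [e e0 eQ]|P Q PQ [d d0 dP]]; first by exists 1.
  exists (Num.min d e) => [|z]; first by rewrite lt_min d0.
  by rewrite lt_min => /andP[/dP Pz /eQ].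
by exists d => // z /dP /PQ.
Qed.

Lemma cvg_set_val a : set_val z @[z --> plane_nbhs a] --> set_val a.
Proof. by apply/cvg_modcP => e e0; exists e. Qed.

End SubspaceNbhs.

(** * Differentiation in plane sets *)

Section Calculus.
Context {R : realType}.

Definition has_cderiv {X : set R[i]} (f : X -> R[i]) (a : X) (l : R[i]) :=
  diff_quotient f a @ a^' --> l.

Context {X : planeSet R}.
Implicit Types (f g : X -> R[i]) (a : X) (c l : R[i]).

Lemma set_val_subr_eq0 a (z : X) : (set_val z - set_val a == 0) = (z == a).
Proof. by rewrite subr_eq0; apply: val_eqE. Qed.

Lemma has_cderiv_cderiv f a l : has_cderiv f a l -> cderiv f a = l.
Proof.
have := dnbhs_planeSet_proper a => PF.
by move=> fl; apply: cvg_lim fl; exact: norm_hausdorff.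
Qed.

Lemma has_cderiv_cdiff f a l : has_cderiv f a l -> cdifferentiable f a.
Proof. by move=> fl; apply/cvg_ex; exists l. Qed.

Lemma has_cderivP f a l : has_cderiv f a l <->
  forall e : R, 0 < e -> exists2 d : R, 0 < d & forall z : X,
    modc (set_val z - set_val a) < d ->
    modc (f z - f a - l * (set_val z - set_val a)) <= e * modc (set_val z - set_val a).
Proof.
have := dnbhs_planeSet_proper a => PF.
have quotE z : z != a -> f z - f a - l * (set_val z - set_val a) =
    (diff_quotient f a z - l) * (set_val z - set_val a).
  by move=> za; rewrite mulrBl divfK// set_val_subr_eq0.
split=> [/cvg_modcP fl e e0|fl].
  have /near_planeP[d d0 dP] : \forall z \near a, z != a -> modc (diff_quotient f a z - l) < e.
    exact: fl.
  exists d => // z /dP zP; have [->|/eqP za] := eqVneq z a.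
    by rewrite !subrr mulr0 subr0 modc0 mulr0.
  by rewrite quotE ?modcM ?ler_wpM2r ?modc_ge0 ?ltW ?zP//; apply/eqP.
apply/cvg_modcP => e e0.
have [d d0 dP] := fl _ (divr_gt0 e0 (ltr0n _ 2)).
suff : \forall z \near a, z != a -> modc (diff_quotient f a z - l) < e by [].
apply/near_planeP; exists d => // z /dP + za.
rewrite quotE// modcM ler_pM2r ?modc_gt0 ?set_val_subr_eq0// => /le_lt_trans; apply.
by rewrite ltr_pdivrMr// ltr_pMr// ltr1n.
Qed.

(** Caratheodory's form of differentiability turns the differentiation rules
    into the continuity of algebraic operations. *)
Lemma caratheodory f a l : has_cderiv f a l <->
  exists q : X -> R[i], [/\ q a = l, q z @[z --> plane_nbhs a] --> l &
    forall z, f z = f a + q z * (set_val z - set_val a)].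
Proof.
split=> [/has_cderivP fl|[q [qa ql fq]]].
  exists (fun z => if z == a then l else diff_quotient f a z); split.
  - by rewrite eqxx.
  - apply/cvg_modcP => e e0.
    have [d d0 dP] := fl _ (divr_gt0 e0 (ltr0n _ 2)).
    exists d => // z zd; have [_|za] := eqVneq z a; first by rewrite subrr modc0.
    have := dP z zd.
    have za0 : set_val z - set_val a != 0 by rewrite set_val_subr_eq0.
    have -> : f z - f a - l * (set_val z - set_val a) =
      (diff_quotient f a z - l) * (set_val z - set_val a) by rewrite mulrBl divfK.
    rewrite modcM ler_pM2r ?modc_gt0// => /le_lt_trans; apply.
    by rewrite ltr_pdivrMr// ltr_pMr// ltr1n.
  - move=> z; have [->|za] := eqVneq z a; first by rewrite subrr mulr0 addr0.
    by rewrite divfK ?set_val_subr_eq0// addrC subrK.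
apply/has_cderivP => e e0.
have /cvg_modcP/(_ _ e0)[d d0 dP] := ql.
exists d => // z /dP zd.
by rewrite fq [f a + _]addrC addrK -mulrBl modcM ler_wpM2r ?modc_ge0 ?ltW.
Qed.

Lemma has_cderiv_continuous f a l : has_cderiv f a l -> f z @[z --> plane_nbhs a] --> f a.
Proof.
move=> /caratheodory[q [_ ql fq]].
rewrite (_ : f = fun z => f a + q z * (set_val z - set_val a)); last exact/funext.
rewrite /= subrr mulr0 addr0 -[X in _ --> X]addr0 -[X in _ + X](mulr0 l).
apply: cvgcD; first exact: cvg_cst.
apply: cvgcM; first exact: ql.
rewrite -(subrr (set_val a)).
by apply: cvgcD; [exact: cvg_set_val|exact: cvg_cst].
Qed.

Lemma has_cderiv_cst c a : has_cderiv (cst c : X -> R[i]) a 0.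
Proof.
apply/caratheodory; exists (cst 0); split=> //; first exact: cvg_cst.
by move=> z; rewrite mul0r addr0.
Qed.

Lemma has_cderiv_id a : has_cderiv (set_val : X -> R[i]) a 1.
Proof.
apply/caratheodory; exists (cst 1); split=> //; first exact: cvg_cst.
by move=> z; rewrite mul1r addrC subrK.
Qed.

Lemma has_cderivD f g a l m : has_cderiv f a l -> has_cderiv g a m ->
  has_cderiv (fun z => f z + g z) a (l + m).
Proof.
move=> /caratheodory[p [pa pl fp]] /caratheodory[q [qa ql gq]].
apply/caratheodory; exists (fun z => p z + q z); split; first by rewrite pa qa.
  exact: cvgcD.
by move=> z; rewrite fp gq; ring.
Qed.

Lemma has_cderivM f g a l m : has_cderiv f a l -> has_cderiv g a m ->
  has_cderiv (fun z => f z * g z) a (l * g a + f a * m).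
Proof.
move=> fl; have fc := has_cderiv_continuous fl.
move: fl => /caratheodory[p [pa pl fp]] /caratheodory[q [qa ql gq]].
apply/caratheodory; exists (fun z => p z * g a + f z * q z); split.
- by rewrite pa qa.
- apply: cvgcD; first by apply: cvgcM; [exact: pl|exact: cvg_cst].
  by apply: cvgcM; [exact: fc|exact: ql].
- by move=> z; rewrite gq mulrDr [f z * g a](congr1 (fun x => x * g a) (fp z)); ring.
Qed.

Lemma has_cderivZ c f a l : has_cderiv f a l ->
  has_cderiv (fun z => c * f z) a (c * l).
Proof.
move=> fl; have := has_cderivM (has_cderiv_cst c a) fl.
by rewrite mul0r add0r.
Qed.

Lemma has_cderivB f g a l m : has_cderiv f a l -> has_cderiv g a m ->
  has_cderiv (fun z => f z - g z) a (l - m).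
Proof.
move=> fl gm; have := has_cderivD fl (has_cderivZ (c := -1) gm); rewrite mulN1r.
by rewrite (_ : (fun z => _ + _) = fun z => f z - g z)//; apply/funext => z; rewrite mulN1r.
Qed.

Lemma has_cderiv_sum I (r : seq I) (F : I -> X -> R[i]) (L : I -> R[i]) a :
  (forall i, has_cderiv (F i) a (L i)) ->
  has_cderiv (fun z => \sum_(i <- r) F i z) a (\sum_(i <- r) L i).
Proof.
move=> FL; elim: r => [|i r IHr].
  rewrite big_nil (_ : (fun z => _) = cst 0); first exact: has_cderiv_cst.
  by apply/funext => z; rewrite big_nil.
rewrite big_cons (_ : (fun z => _) = fun z => F i z + \sum_(i <- r) F i z).
  by apply: has_cderivD; [exact: FL|exact: IHr].
by apply/funext => z; rewrite big_cons.
Qed.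

Lemma has_cderivX f a l n : has_cderiv f a l ->
  has_cderiv (fun z => f z ^+ n) a (n%:R * f a ^+ n.-1 * l).
Proof.
move=> fl; elim: n => [|n IHn].
  by rewrite !mul0r; exact: has_cderiv_cst.
have := has_cderivM fl IHn.
rewrite (_ : (fun z => _ * _) = fun z => f z ^+ n.+1); last first.
  by apply/funext => z; rewrite exprS.
rewrite (_ : l * _ + _ = n.+1%:R * f a ^+ n.+1.-1 * l)//=.
case: n {IHn} => [|n] /=; first by ring.
by rewrite -(natr1 n.+1) [f a ^+ n.+1]exprS; ring.
Qed.

Lemma has_cderivV f a l : f a != 0 -> has_cderiv f a l ->
  has_cderiv (fun z => (f z)^-1) a (- (f a) ^- 2 * l).
Proof.
move=> fa0 fl; have fc := has_cderiv_continuous fl.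
move: fl => /caratheodory[p [pa pl fp]].
(* Close to a the values of f are at distance less than |f a| from f a, hence
   do not vanish. *)
have /cvg_modcP/(_ (modc (f a)))/= := fc; rewrite modc_gt0 => /(_ fa0)[d1 d10 nz].
have : has_cderiv (fun z => (f z)^-1) a ((-1) * ((f a)^-1 * (f a)^-1 * l)).
  apply/has_cderivP => e e0.
  have : (-1) * ((f z)^-1 * (f a)^-1 * p z) @[z --> plane_nbhs a] --> (-1) * ((f a)^-1 * (f a)^-1 * l).
    by apply: cvgcM; first exact: cvg_cst; apply: cvgcM; last exact: pl; apply: cvgcM; [exact: cvgcV|exact: cvg_cst].
  move=> /cvg_modcP/(_ _ e0)[d2 d20 near_e].
  exists (Num.min d1 d2) => [|z]; first by rewrite lt_min d10.
  rewrite lt_min => /andP[/nz zfa /near_e ze].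
  have fz0 : f z != 0.
    by apply/eqP => fz; move: zfa; rewrite fz sub0r modcN ltxx.
  have -> : (f z)^-1 - (f a)^-1 = (-1) * ((f z)^-1 * (f a)^-1 * p z) * (set_val z - set_val a).
    have -> : (-1) * ((f z)^-1 * (f a)^-1 * p z) * (set_val z - set_val a) =
      - ((f z)^-1 * (f a)^-1 * (p z * (set_val z - set_val a))) by ring.
    have -> : p z * (set_val z - set_val a) = f z - f a by rewrite fp [RHS]addrC addKr.
    by field; apply/andP.
  by rewrite -mulrBl modcM ler_wpM2r ?modc_ge0 ?ltW.
by rewrite mulN1r -invfM -expr2 mulNr.
Qed.

End Calculus.

Lemma has_cderiv_comp {R : realType} {X Y : planeSet R} (f : X -> R[i]) (h : Y -> X) (b : Y)
    (l m : R[i]) :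
  has_cderiv f (h b) l -> has_cderiv (set_val \o h) b m ->
  has_cderiv (f \o h) b (l * m).
Proof.
move=> /caratheodory[p [pa pl fp]] hm.
have hc : h @ plane_nbhs b `=>` plane_nbhs (h b).
  move=> P [d d0 dP]; have /cvg_modcP/(_ _ d0) := has_cderiv_continuous hm.
  by apply: filterS => z /dP.
move: hm => /caratheodory[q [qa ql hq]].
apply/caratheodory; exists (fun z => p (h z) * q z); split; first by rewrite pa qa.
  by apply: cvgcM; [exact: cvg_trans (cvg_app p hc) pl|exact: ql].
move=> z /=; rewrite fp.
have -> : set_val (h z) - set_val (h b) = q z * (set_val z - set_val b).
  by have /= -> := hq z; rewrite [LHS]addrC addKr.
by rewrite mulrA.
Qed.

(** * Higher derivatives *)

Section HigherDerivatives.
Context {R : realType}.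

Definition ncdiff {X : set R[i]} n (f : X -> R[i]) :=
  forall k a, (k < n)%N -> cdifferentiable (cderivn k f) a.

Context {X : planeSet R}.
Implicit Types (f g : X -> R[i]) (a : X) (c l : R[i]).

Lemma cderivnS n f : cderivn n.+1 f = cderivn n (cderiv f).
Proof. by rewrite /cderivn iterSr. Qed.

Lemma Dinfty_ncdiff f : Dinfty f <-> forall n, ncdiff n f.
Proof.
split=> [fD n k a _|fn n a]; first exact: fD.
exact: (fn n.+1 n a).
Qed.

Lemma ncdiffS n f :
  ncdiff n.+1 f <-> (forall a, cdifferentiable f a) /\ ncdiff n (cderiv f).
Proof.
split=> [fn|[f1 fn]].
  split=> [a|k a kn]; first exact: (fn 0%N).
  by rewrite -cderivnS; exact: fn.
move=> [|k] a kn; first exact: f1.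
by rewrite cderivnS; exact: fn.
Qed.

Lemma ncdiff_le m n f : (m <= n)%N -> ncdiff n f -> ncdiff m f.
Proof. by move=> mn fn k a km; apply: fn; exact: leq_trans mn. Qed.

Lemma has_cderivn n k f a : ncdiff n f -> (k < n)%N ->
  has_cderiv (cderivn k f) a (cderivn k.+1 f a).
Proof. by move=> fn kn; exact: (fn k a kn). Qed.

Lemma Dinfty_cderivn n f : Dinfty f -> Dinfty (cderivn n f).
Proof. by move=> fD k a; rewrite /cderivn -iterD; exact: fD. Qed.

(** Exhibiting the candidates for all derivatives at once is the way in which
    smoothness is established below. *)
Lemma cderivn_seq N (g : nat -> X -> R[i]) :
  (forall n a, (n < N)%N -> has_cderiv (g n) a (g n.+1 a)) ->
  ncdiff N (g 0%N) /\ forall n, (n <= N)%N -> cderivn n (g 0%N) = g n.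
Proof.
move=> gP.
have gE n : (n <= N)%N -> cderivn n (g 0%N) = g n.
  elim: n => [|n IHn nN].
    by [].
  rewrite /cderivn iterS -/(cderivn n _).
  rewrite IHn; last exact: ltnW.
  by apply/funext => a; apply: has_cderiv_cderiv; exact: gP.
split; last exact: gE.
by move=> k a kN; rewrite (gE _ (ltnW kN)); exact: has_cderiv_cdiff (gP _ _ kN).
Qed.

Lemma Dinfty_seq (g : nat -> X -> R[i]) :
  (forall n a, has_cderiv (g n) a (g n.+1 a)) ->
  Dinfty (g 0%N) /\ forall n, cderivn n (g 0%N) = g n.
Proof.
move=> gP; split=> [|n].
  by apply/Dinfty_ncdiff => n; have [] := @cderivn_seq n g (fun k a _ => gP k a).
by have [_ ->] := @cderivn_seq n g (fun k a _ => gP k a).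
Qed.

(** Only finite orders of differentiability are assumed, because the smoothness
    of composites is proved by induction on the order. *)
Lemma leibniz N f g : ncdiff N f -> ncdiff N g ->
  ncdiff N (fun z => f z * g z) /\
  forall n, (n <= N)%N -> cderivn n (fun z => f z * g z) =
    fun z => \sum_(k < n.+1) 'C(n, k)%:R * (cderivn k f z * cderivn (n - k) g z).
Proof.
move=> fN gN.
pose h n z := \sum_(k < n.+1) 'C(n, k)%:R * (cderivn k f z * cderivn (n - k) g z).
have h0 : (fun z => f z * g z) = h 0%N.
  by apply/funext => z; rewrite /h big_ord1 bin0 mul1r.
rewrite h0; apply: cderivn_seq => n a nN.
have -> : h n.+1 a = \sum_(k < n.+1) 'C(n, k)%:R *
    (cderivn k.+1 f a * cderivn (n - k) g a + cderivn k f a * cderivn (n - k).+1 g a).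
  rewrite /h big_ord_recl /= bin0.
  under eq_bigr => k _ do rewrite /bump /= add1n binS natrD mulrDl.
  rewrite big_split /= big_ord_recr /= (bin_small (ltnSn n)) mul0r addr0.
  rewrite addrA [RHS](eq_bigr (fun k : 'I_n.+1 =>
    'C(n, k)%:R * (cderivn k f a * cderivn (n - k).+1 g a) +
    'C(n, k)%:R * (cderivn k.+1 f a * cderivn (n - k) g a))); last first.
    by move=> k _; rewrite mulrDr addrC.
  rewrite big_split /=; congr (_ + _).
  rewrite [RHS]big_ord_recl /= bin0; congr (_ + _); first by rewrite subn0.
  by apply: eq_bigr => k _; rewrite /bump /= add1n subSS -(subnSK (ltn_ord k)).
apply: has_cderiv_sum => k; apply: has_cderivZ; apply: has_cderivM.
  by apply: has_cderivn fN _; apply: leq_ltn_trans nN; rewrite -ltnS.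
by apply: has_cderivn gN _; apply: leq_ltn_trans nN; exact: leq_subr.
Qed.

End HigherDerivatives.

Section Composition.
Context {R : realType} {X Y : planeSet R} (h : Y -> X).
Implicit Types (f : X -> R[i]) (b : Y).

Lemma cderiv_comp f : (forall a, cdifferentiable f a) ->
  (forall b, cdifferentiable (set_val \o h) b) ->
  (forall b, cdifferentiable (f \o h) b) /\
  cderiv (f \o h) = fun z => (cderiv f \o h) z * cderiv (set_val \o h) z.
Proof.
move=> f1 h1.
have fh b : has_cderiv (f \o h) b (cderiv f (h b) * cderiv (set_val \o h) b).
  by apply: has_cderiv_comp; [exact: f1|exact: h1].
split=> [b|]; first exact: has_cderiv_cdiff (fh b).
by apply/funext => b; exact: has_cderiv_cderiv (fh b).
Qed.

Lemma ncdiff_comp N f : ncdiff N f -> ncdiff N (set_val \o h) -> ncdiff N (f \o h).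
Proof.
elim: N f => [|N IHN] f fN hN; first by move=> k a.
have /ncdiffS[f1 fN'] := fN; have /ncdiffS[h1 hN'] := hN.
have [fh1 fh'] := cderiv_comp f1 h1.
apply/ncdiffS; split; first exact: fh1.
rewrite fh'; apply: (proj1 (leibniz _ hN')).
by apply: IHN; [exact: fN'|exact: ncdiff_le hN].
Qed.

Lemma Dinfty_comp f : Dinfty f -> Dinfty (set_val \o h) -> Dinfty (f \o h).
Proof.
move=> /Dinfty_ncdiff fD /Dinfty_ncdiff hD; apply/Dinfty_ncdiff => n.
by apply: ncdiff_comp; [exact: fD|exact: hD].
Qed.

(** The chain rule reduces the derivatives of a composite to lower ones, of
    the composite with the derivative; iterating it would give the formula of
    Faa di Bruno. *)
Lemma cderivn_compS n f b : Dinfty f -> Dinfty (set_val \o h) ->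
  cderivn n.+1 (f \o h) b = \sum_(k < n.+1) 'C(n, k)%:R *
    (cderivn (n - k) (cderiv f \o h) b * cderivn k.+1 (set_val \o h) b).
Proof.
move=> fD hD; rewrite cderivnS.
have [_ ->] := cderiv_comp (fD 0%N) (hD 0%N).
have f'hD : Dinfty (cderiv f \o h).
  by apply: Dinfty_comp; [exact: (@Dinfty_cderivn _ _ 1)|exact: hD].
have h'D : Dinfty (cderiv (set_val \o h)) by exact: (@Dinfty_cderivn _ _ 1).
have [_ /(_ n (leqnn n)) ->] := @leibniz _ _ n (cderiv f \o h) (cderiv (set_val \o h))
  ((Dinfty_ncdiff _).1 f'hD n) ((Dinfty_ncdiff _).1 h'D n).
rewrite [LHS](reindex_inj rev_ord_inj) /=; apply: eq_bigr => k _.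
by rewrite subSS bin_sub ?subKn -?cderivnS// -ltnS.
Qed.

End Composition.

(** * Segments in the disc and the mean value inequality *)

Section ClosedDisc.
Context {R : realType}.
Notation disc := (closed_disc R).
Implicit Types (z w : disc) (f : disc -> R[i]).

Lemma disc_modc z : modc (set_val z) <= 1.
Proof.
have : disc_set (set_val z) by rewrite set_valE; case: z => x /= /set_mem.
by rewrite disc_setE.
Qed.

Lemma disc_pt_subproof (x : R[i]) : exists z : disc, modc x <= 1 -> set_val z = x.
Proof.
have [x1|x1] := boolP (modc x <= 1).
  have Dx : disc_set x by rewrite disc_setE.
  by exists (exist _ x (mem_set Dx)).
by have [y /mem_set Dy] := @disc_set_neq0 R; exists (exist _ y Dy).
Qed.

(** Outside the disc the value is an arbitrary point of the disc. *)
Definition disc_pt (x : R[i]) : disc := sval (cid (disc_pt_subproof x)).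

Lemma disc_ptK x : modc x <= 1 -> set_val (disc_pt x) = x.
Proof. by rewrite /disc_pt; case: cid => z /= /[apply]. Qed.

Lemma set_val_inj z w : set_val z = set_val w -> z = w.
Proof. exact: val_inj. Qed.

Lemma set_valK z : disc_pt (set_val z) = z.
Proof. by apply: set_val_inj; rewrite disc_ptK ?disc_modc. Qed.

(** Truncating the parameter keeps the segment inside the disc, so that it is
    defined and continuous on the whole line. *)
Definition seg w z (t : R) : disc :=
  disc_pt (set_val w + (Num.max 0 (Num.min t 1))%:C%C * (set_val z - set_val w)).

Lemma seg_clamp w z t : set_val (seg w z t) =
  set_val w + (Num.max 0 (Num.min t 1))%:C%C * (set_val z - set_val w).
Proof.
apply: disc_ptK; set s := Num.max _ _.
have s0 : 0 <= s by rewrite le_max lexx.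
have s1 : s <= 1 by rewrite ge_max ler01 ge_min lexx orbT.
have -> : set_val w + s%:C%C * (set_val z - set_val w) =
    (1 - s)%:C%C * set_val w + s%:C%C * set_val z by rewrite rmorphB rmorph1; ring.
apply: le_trans (modcD _ _) _.
rewrite !modcM !modc_real (ger0_norm s0) ger0_norm ?subr_ge0//.
have := disc_modc w; have := disc_modc z => zD wD.
have : (1 - s) * modc (set_val w) <= (1 - s) * 1 by rewrite ler_wpM2l// subr_ge0.
have : s * modc (set_val z) <= s * 1 by rewrite ler_wpM2l.
lra.
Qed.

Lemma segE w z t : 0 <= t <= 1 ->
  set_val (seg w z t) = set_val w + t%:C%C * (set_val z - set_val w).
Proof. by move=> /andP[t0 t1]; rewrite seg_clamp (min_l t1) (max_r t0). Qed.

Lemma seg0 w z : seg w z 0 = w.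
Proof.
by apply: set_val_inj; rewrite segE ?lexx ?ler01// mul0r addr0.
Qed.

Lemma seg1 w z : seg w z 1 = z.
Proof.
by apply: set_val_inj; rewrite segE ?lexx ?ler01// mul1r addrC subrK.
Qed.

Lemma seg_dist w z s t :
  modc (set_val (seg w z s) - set_val (seg w z t)) <= `|s - t| * modc (set_val z - set_val w).
Proof.
rewrite !seg_clamp [X in X - _]addrC addrKA -mulrBl -rmorphB modcM modc_real.
rewrite ler_wpM2r ?modc_ge0//.
have ds : s - t <= `|s - t| by exact: ler_norm.
have dt : t - s <= `|s - t| by rewrite distrC ler_norm.
rewrite ler_norml /Num.max /Num.min.
by case: (ltP s 1) => ?; case: (ltP t 1) => ?; repeat case: ltP => ?;
  apply/andP; split; lra.
Qed.

Lemma is_derive_eps (h : R -> R) (t l : R) :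
  (forall e : R, 0 < e -> exists2 d : R, 0 < d & forall s : R, `|s - t| < d ->
    `|h s - h t - l * (s - t)| <= e * `|s - t|) -> is_derive t 1 h l.
Proof.
move=> ht.
have : (fun s => s^-1 *: ((h \o shift t) (s *: 1) - h t)) @ 0^' --> l.
  apply/cvgrPdist_lt => e e0.
  have [d d0 dP] := ht _ (divr_gt0 e0 (ltr0n _ 2)).
  exists d => //= s /=; rewrite sub0r normrN => sd s0.
  have := dP (s + t); rewrite addrK => /(_ sd) hs.
  rewrite distrC /= /shift /= /GRing.scale /= mulr1.
  have -> : s^-1 * (h (s + t) - h t) - l = s^-1 * (h (s + t) - h t - l * s).
    by rewrite [RHS]mulrBr; congr (_ - _); rewrite mulrCA mulVf// mulr1.
  rewrite normrM normfV ltr_pdivrMl ?normr_gt0// [ltRHS]mulrC.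
  apply: le_lt_trans hs _; rewrite ltr_pM2r ?normr_gt0//.
  by rewrite ltr_pdivrMr// ltr_pMr// ltr1n.
move=> hl; apply: DeriveDef; first by apply/cvg_ex; exists l.
exact: cvg_lim hl.
Qed.

Lemma unit_multiplier (v : R[i]) :
  exists2 u : R[i], modc u <= 1 & complex.Re (u * v) = modc v.
Proof.
have [->|v0] := eqVneq v 0.
  by exists 0; rewrite ?mul0r ?modc0.
exists ((v^*)%C / (modc v)%:C%C).
  rewrite modcM modcV modc_real ger0_norm ?modc_ge0//.
  have -> : modc (v^*)%C = modc v by apply: complexI; rewrite -!normcE normcJ.
  by rewrite divff// modc_eq0.
rewrite mulrAC [_ * v]mulrC -sqr_normc -normcE expr2 mulfK//.
by rewrite normr_eq0.
Qed.

(** The mean value theorem for real functions applies to the real part of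
    [u * f], where [u] is the unimodular number that makes the increment of [f]
    real and positive. *)
Lemma mean_value_segment f (df : R -> R[i]) (K : R) w z :
  (forall t, has_cderiv f (seg w z t) (df t)) ->
  (forall t : R, 0 <= t <= 1 -> modc (df t) <= K) ->
  modc (f z - f w) <= K * modc (set_val z - set_val w).
Proof.
move=> fd fK.
have K0 : 0 <= K by apply: le_trans (fK 0 _); rewrite ?modc_ge0// lexx ler01.
set v := set_val z - set_val w.
have [u u1 uE] := unit_multiplier (f z - f w).
pose h t := complex.Re (u * f (seg w z t)).
have ReB (x y : R[i]) : complex.Re x - complex.Re y = complex.Re (x - y).
  by case: x; case: y.
have absRe (x : R[i]) : `|complex.Re x| <= modc x.
  rewrite ler_norml Re_le_modc andbT lerNl -[X in _ <= X]modcN.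
  by apply: le_trans (Re_le_modc _); case: x.
have hcont : continuous h.
  move=> t; apply/cvgrPdist_lt => e e0.
  have /cvg_modcP/(_ _ e0)[d d0 dP] := has_cderiv_continuous (fd t).
  have v1 : 0 < modc v + 1 by rewrite ltr_wpDl ?modc_ge0.
  exists (d / (modc v + 1)) => /=; first by rewrite divr_gt0.
  move=> s /= st.
  rewrite ReB; apply: le_lt_trans (absRe _) _.
  rewrite -mulrBr modcM; apply: le_lt_trans (_ : _ <= modc (f (seg w z s) - f (seg w z t))) _.
    by rewrite -[leRHS]mul1r modc_dist ler_wpM2r ?modc_ge0.
  apply: dP; apply: le_lt_trans (seg_dist _ _ _ _) _.
  rewrite distrC; apply: le_lt_trans (_ : `|t - s| * (modc v + 1) < d).
    by rewrite ler_wpM2l// lerDl.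
  by rewrite -ltr_pdivlMr.
have hder (t : R) : t \in `]0, 1[ -> is_derive t 1 h (complex.Re (u * (df t * v))).
  rewrite in_itv /= => /andP[t0 t1]; apply: is_derive_eps => e e0.
  have v1 : 0 < modc v + 1 by rewrite ltr_wpDl ?modc_ge0.
  have /has_cderivP/(_ _ (divr_gt0 e0 v1))[d d0 dP] := fd t.
  exists (Num.min (d / (modc v + 1)) (Num.min t (1 - t))).
    by rewrite !lt_min divr_gt0// t0 subr_gt0.
  move=> s; rewrite !lt_min => /and3P[sd st st1].
  have s01 : 0 <= s <= 1.
    by move: st st1; rewrite !ltr_norml => /andP[? ?] /andP[? ?]; apply/andP; split; lra.
  have segst : set_val (seg w z s) - set_val (seg w z t) = (s - t)%:C%C * v.
    by rewrite !segE ?(ltW t0) ?(ltW t1)// rmorphB /= /v; ring.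
  have := dP (seg w z s); rewrite segst modcM modc_real.
  have vs : `|s - t| * modc v <= `|s - t| * (modc v + 1) by rewrite ler_wpM2l// lerDl.
  move=> /(_ (le_lt_trans vs _)); rewrite -ltr_pdivlMr// => /(_ sd) fs.
  rewrite /h ReB -(_ : complex.Re (u * (df t * ((s - t)%:C%C * v))) = complex.Re (u * (df t * v)) * (s - t)).
    rewrite ReB -!mulrBr; apply: le_trans (absRe _) _; rewrite modcM.
    apply: le_trans (_ : modc (f (seg w z s) - f (seg w z t) - df t * ((s - t)%:C%C * v)) <= _).
      by rewrite -[leRHS]mul1r ler_wpM2r ?modc_ge0.
    apply: le_trans fs _; rewrite mulrAC ler_pdivrMr//.
    by rewrite -mulrA ler_pM2l.
  have -> : u * (df t * ((s - t)%:C%C * v)) = u * (df t * v) * (s - t)%:C%C by ring.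
  by case: (u * _) => x y /=; rewrite mulr0 subr0.
have [|c c01] := MVT_segment ler01 hder.
  exact: continuous_subspaceT.
rewrite subr0 mulr1 /h seg1 seg0 ReB -mulrBr uE => ->.
apply: le_trans (Re_le_modc _) _.
rewrite !modcM; apply: le_trans (_ : modc (df c) * modc v <= _).
  by rewrite -[leRHS]mul1r ler_wpM2r ?mulr_ge0 ?modc_ge0.
by rewrite ler_wpM2r ?modc_ge0// fK.
Qed.

End ClosedDisc.

(** * Compactness of the disc and Taylor expansion *)

Section DiscCalculus.
Context {R : realType}.
Notation disc := (closed_disc R).
Implicit Types (z w a : disc) (f : disc -> R[i]).

(** The near-covering form of compactness. It serves with two filters: small
    positive gaps, and an ultrafilter of functions. *)
Lemma disc_compactness {I : Type} {F : set_system I} {FF : Filter F}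
    (P : I -> disc -> Prop) :
  (forall a, exists2 d : R, 0 < d & \forall i \near F, forall z,
      modc (set_val z - set_val a) < d -> P i z) ->
  \forall i \near F, forall z, P i z.
Proof.
move=> locP.
have /compact_near_coveringP cov := @disc_set_compact R.
have := cov I F (fun i x => disc_set x -> P i (disc_pt x)) FF.
move=> H; have {H} : \forall i \near F, disc_set `<=` (fun x => disc_set x -> P i (disc_pt x)).
  apply: H => x Dx.
  have x1 : modc x <= 1 by rewrite -disc_setE.
  have [d d0 dP] := locP (disc_pt x).
  exists (ball x d%:C%C, fun i => forall z, modc (set_val z - set_val (disc_pt x)) < d -> P i z).
    by split; [apply: nbhsx_ballx; rewrite ltcR|exact: dP].
  move=> [y i] /= [xy iP] Dy; apply: iP.
  rewrite !disc_ptK -?disc_setE// -ltcR -normcE distrC.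
  by move: xy; rewrite -ball_normE.
apply: filterS => i Pi z; rewrite -(set_valK z); apply: Pi; rewrite disc_setE; exact: disc_modc.
Qed.

Lemma mean_value_disc f (K : R) w z : (forall a, cdifferentiable f a) ->
  (forall a, modc (cderiv f a) <= K) ->
  modc (f z - f w) <= K * modc (set_val z - set_val w).
Proof.
move=> f1 fK; apply: (@mean_value_segment _ f (fun t => cderiv f (seg w z t))).
  by move=> t; exact: f1.
by move=> t _; exact: fK.
Qed.

Lemma seg_dist1 w z t : 0 <= t <= 1 ->
  modc (set_val (seg w z t) - set_val w) <= modc (set_val z - set_val w).
Proof.
move=> /andP[t0 t1]; rewrite -{2}(seg0 w z); apply: le_trans (seg_dist _ _ _ _) _.
by rewrite subr0 ger0_norm// -[leRHS]mul1r ler_wpM2r ?modc_ge0.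
Qed.

Definition taylor n f w (x : R[i]) : R[i] :=
  \sum_(k < n) cderivn k f w / k`!%:R * (x - set_val w) ^+ k.

(** The remainder vanishes at [w], and its derivative is the remainder, of order
    one less, of the derivative; the mean value inequality integrates it. *)
Lemma taylor_remainder n f (K : R) w z : Dinfty f ->
  (forall a, modc (cderivn n f a) <= K) ->
  modc (f z - taylor n f w (set_val z)) <= K * modc (set_val z - set_val w) ^+ n.
Proof.
elim: n f z => [|n IHn] f z fD fK.
  by rewrite /taylor big_ord0 subr0 expr0 mulr1; exact: fK.
have f'D : Dinfty (cderiv f) by exact: (@Dinfty_cderivn _ _ 1).
pose g x := f x - taylor n.+1 f w (set_val x).
have gw : g w = 0.
  rewrite /g /taylor big_ord_recl /= fact0 divr1 expr0 mulr1 subrr.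
  rewrite big1 ?addr0 ?subrr// => k _.
  by rewrite exprS mul0r mulr0.
have gd a : has_cderiv g a (cderiv f a - taylor n (cderiv f) w (set_val a)).
  apply: has_cderivB; first exact: (fD 0%N).
  rewrite (_ : taylor n _ _ _ = \sum_(k < n.+1) cderivn k f w / k`!%:R *
      (k%:R * (set_val a - set_val w) ^+ k.-1 * (1 - 0))); last first.
    rewrite [RHS]big_ord_recl /= !mul0r mulr0 add0r; apply: eq_bigr => k _.
    rewrite -cderivnS /bump /= add1n factS natrM subr0 mulr1 add0n.
    have k0 : k.+1%:R != 0 :> R[i] by rewrite pnatr_eq0.
    have kf0 : k`!%:R != 0 :> R[i] by rewrite pnatr_eq0 -lt0n fact_gt0.
    move: k0 kf0; move: (k.+1%:R : R[i]) (k`!%:R : R[i]) => u v u0 v0.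
    by field; rewrite u0 v0.
  apply: has_cderiv_sum => k; apply: has_cderivZ; apply: has_cderivX.
  by apply: has_cderivB; [exact: has_cderiv_id|exact: has_cderiv_cst].
have -> : f z - taylor n.+1 f w (set_val z) = g z - g w by rewrite gw subr0.
have K0 : 0 <= K by apply: le_trans (fK w); rewrite modc_ge0.
rewrite exprSr mulrA; apply: (mean_value_segment (df := fun t =>
  cderiv f (seg w z t) - taylor n (cderiv f) w (set_val (seg w z t)))).
  by move=> t; exact: gd.
move=> t t01; apply: le_trans (IHn _ _ f'D _) _ => [a|].
  by rewrite -cderivnS; exact: fK.
by rewrite ler_wpM2l// lerXn2r ?nnegrE ?modc_ge0// seg_dist1.
Qed.

Lemma quadratic_remainder f (K : R) w z : Dinfty f ->
  (forall a, modc (cderivn 2 f a) <= K) ->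
  modc (f z - f w - cderiv f w * (set_val z - set_val w)) <=
    K * modc (set_val z - set_val w) ^+ 2.
Proof.
move=> fD /(taylor_remainder w z fD).
rewrite /taylor !big_ord_recl big_ord0 /= fact0 !divr1 expr0 expr1 mulr1 addr0.
by rewrite opprD addrA.
Qed.

End DiscCalculus.

(** * Roots of unity *)

Section RootsOfUnity.
Context {R : realType}.

Definition expi (x : R) : R[i] := (cos x +i* sin x)%C.

Lemma expiX x n : expi x ^+ n = expi (n%:R * x).
Proof.
elim: n => [|n IHn]; first by rewrite mul0r /expi cos0 sin0.
rewrite exprS IHn -natr1 mulrDl mul1r [_ + x]addrC /expi cosD sinD.
by apply/eqP; rewrite eq_complex /=; apply/andP; split; apply/eqP; ring.
Qed.

Lemma expi_2pi : expi (2 * pi) = 1.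
Proof. by rewrite /expi mulr_natl cos2pi sin2pi. Qed.

Lemma expi_neq1 x : 0 < x < 2 * pi -> expi x != 1.
Proof.
move=> /andP[x0 x2]; rewrite /expi eq_complex /=; apply/negP => /andP[/eqP + _].
have s0 : 0 < sin (x / 2).
  by apply: sin_gt0_pi; rewrite divr_gt0//= ltr_pdivrMr// mulrC.
have -> : cos x = 1 - 2 * sin (x / 2) ^+ 2.
  have {1}-> : x = (x / 2) + (x / 2) by rewrite -splitr.
  by rewrite cosD -!expr2 cos2sin2; ring.
have : 0 < sin (x / 2) ^+ 2 by rewrite exprn_gt0.
lra.
Qed.

Lemma modc_expi x : modc (expi x) = 1.
Proof. by rewrite /= cos2Dsin2 sqrtr1. Qed.

Lemma modc_expi_sub1 x : modc (expi x - 1) ^+ 2 = 2 - 2 * cos x.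
Proof.
rewrite /= sqr_sqrtr ?addr_ge0 ?sqr_ge0// subr0.
have := cos2Dsin2 x; rewrite !expr2; lra.
Qed.

(** These roots provide arbitrarily fine regular subdivisions of the circle;
    that their first powers differ from 1 makes the averages of the low-degree
    monomials vanish. *)
Lemma root_of_unity_near1 k (e : R) : 0 < e -> exists N (om : R[i]),
  [/\ (0 < N)%N, om ^+ N = 1, modc om = 1, modc (om - 1) < e &
      forall i, (0 < i <= k)%N -> om ^+ i != 1].
Proof.
move=> e0.
have : cos x @[x --> (0 : R)] --> cos 0 by exact: continuous_cos.
have e2 : 0 < e ^+ 2 / 2 by rewrite divr_gt0// exprn_gt0.
move=> /cvgrPdist_lt/(_ _ e2)[d /= d0 dP].
have pi0 : 0 < 2 * pi :> R by rewrite mulr_gt0// pi_gt0.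
pose N := maxn k.+1 (Num.truncn (2 * pi / d)).+1.
have N0 : (0 < N)%N by rewrite leq_max.
have NR : 0 < N%:R :> R by rewrite ltr0n.
exists N, (expi (2 * pi / N%:R)); split => //.
- by rewrite expiX mulrC divfK ?gt_eqF// expi_2pi.
- exact: modc_expi.
- have : `|cos 0 - cos (2 * pi / N%:R)| < e ^+ 2 / 2 :> R.
    apply: dP => /=; rewrite sub0r normrN gtr0_norm ?divr_gt0//.
    rewrite ltr_pdivrMr// [ltRHS]mulrC -ltr_pdivrMr//.
    apply: lt_le_trans (truncnS_gt _) _.
    by rewrite ler_nat leq_max leqnn orbT.
  rewrite cos0 ltr_norml => /andP[_ ce].
  rewrite -(ltr_pXn2r (n := 2)) ?nnegrE ?modc_ge0 ?(ltW e0)//.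
  rewrite modc_expi_sub1; lra.
- move=> i /andP[i0 ik]; rewrite expiX; apply: expi_neq1.
  have iN : i%:R < N%:R :> R by rewrite ltr_nat leq_max ltnS ik.
  rewrite mulr_gt0 ?divr_gt0 ?ltr0n//= mulrA ltr_pdivrMr//.
  by rewrite [ltRHS]mulrC ltr_pM2r.
Qed.

Lemma sum_root_of_unity (om : R[i]) N : om ^+ N = 1 -> om != 1 ->
  \sum_(j < N) om ^+ j = 0.
Proof.
move=> omN om1; have := subrX1 om N; rewrite omN subrr => /esym/eqP.
by rewrite mulf_eq0 subr_eq0 (negPf om1) => /eqP.
Qed.

Lemma modc_expr_sub1 (om : R[i]) n : modc om = 1 ->
  modc (om ^+ n - 1) <= n%:R * modc (om - 1).
Proof.
move=> om1; rewrite subrX1 modcM mulrC ler_wpM2r ?modc_ge0//.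
apply: le_trans (modc_sum _ _ _) _.
rewrite (eq_bigr (fun=> 1)); last by move=> i _; rewrite modcX om1 expr1n.
by rewrite sumr_const card_ord.
Qed.

End RootsOfUnity.

(** * Cauchy's estimate *)

Section CauchyEstimate.
Context {R : realType}.
Notation disc := (closed_disc R).
Variables (f : disc -> R[i]) (x : R[i]) (d B K2 : R) (k : nat).
Hypotheses (fD : Dinfty f) (d0 : 0 <= d) (xd : modc x + d <= 1).
Hypotheses (fB : forall a, modc (f a) <= B).
Hypotheses (fK2 : forall a, modc (cderivn 2 f a) <= K2).

Lemma subdisc_pt (c : R[i]) (s : disc) : modc c <= d ->
  set_val (disc_pt (x + c * set_val s)) = x + c * set_val s.
Proof.
move=> cd; apply: disc_ptK; apply: le_trans (modcD _ _) _; apply: le_trans xd.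
by rewrite lerD2l modcM; apply: le_trans cd; rewrite ler_piMr ?modc_ge0 ?disc_modc.
Qed.

Lemma has_cderiv_subdisc (g : disc -> R[i]) (c l : R[i]) (s : disc) : modc c <= d ->
  has_cderiv g (disc_pt (x + c * set_val s)) l ->
  has_cderiv (fun s => g (disc_pt (x + c * set_val s))) s (l * c).
Proof.
move=> cd gl.
apply: (has_cderiv_comp (h := fun s : disc => disc_pt (x + c * set_val s)) gl).
rewrite (_ : _ \o _ = fun s : disc => x + c * set_val s); last first.
  by apply/funext => t /=; rewrite subdisc_pt.
rewrite -[X in has_cderiv _ _ X]add0r -[X in _ + X]mulr1.
apply: has_cderivD; first exact: has_cderiv_cst.
by apply: has_cderivZ; exact: has_cderiv_id.
Qed.

Variables (N : nat) (om : R[i]).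
Hypotheses (N0 : (0 < N)%N) (omN : om ^+ N = 1) (om1 : modc om = 1).

Let D : R[i] := d%:C%C.

Let node (j : nat) (s : disc) : disc := disc_pt (x + D * om ^+ j * set_val s).

(** The discrete version of the [k]-th Fourier coefficient of [f] on the circle
    of radius [d * |s|] around [x], as a function of [s]. *)
Definition circle_avg (s : disc) : R[i] :=
  N%:R^-1 * \sum_(j < N) (om ^+ j) ^- k * f (node j s).

Definition circle_avg' (s : disc) : R[i] :=
  N%:R^-1 * \sum_(j < N) (om ^+ j) ^- k * (cderiv f (node j s) * (D * om ^+ j)).

Let node_d j : modc (D * om ^+ j) <= d.
Proof. by rewrite modcM modcX om1 expr1n mulr1 modc_real ger0_norm. Qed.

Let om_neq0 : om != 0.
Proof. by rewrite -modc_gt0 om1. Qed.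

Let NR : N%:R != 0 :> R[i].
Proof. by rewrite pnatr_eq0 -lt0n. Qed.

Lemma has_cderiv_circle_avg s : has_cderiv circle_avg s (circle_avg' s).
Proof.
apply: has_cderivZ; apply: has_cderiv_sum => j; apply: has_cderivZ.
exact: (has_cderiv_subdisc (g := f) (node_d j) (@fD 0%N (node j s))).
Qed.

Let modc_avg (F : nat -> R[i]) (C : R) : (forall j, modc (F j) <= C) ->
  modc (N%:R^-1 * \sum_(j < N) (om ^+ j) ^- k * F j) <= C.
Proof.
move=> FC; rewrite modcM modcV modc_nat.
rewrite ler_pdivrMl ?ltr0n//; apply: le_trans (modc_sum _ _ _) _.
apply: le_trans (_ : _ <= \sum_(j < N) C) _; last first.
  by rewrite sumr_const card_ord mulr_natl.
apply: ler_sum => j _.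
by rewrite modcM modcV !modcX om1 !expr1n invr1 mul1r.
Qed.

(** Summation by parts over the circle replaces the integration by parts of
    the angular derivative. *)
Let summation_by_parts s : modc ((om ^+ k - 1) * circle_avg s -
    (om - 1) * (set_val s * circle_avg' s)) <= K2 * modc (om - 1) ^+ 2.
Proof.
pose E j := f (node j.+1 s) - f (node j s) -
  cderiv f (node j s) * (set_val (node j.+1 s) - set_val (node j s)).
have d1 : d <= 1 by apply: le_trans xd; rewrite lerDr modc_ge0.
have K20 : 0 <= K2 by apply: le_trans (fK2 s); rewrite modc_ge0.
have nodeB j : set_val (node j.+1 s) - set_val (node j s) = D * om ^+ j * set_val s * (om - 1).
  by rewrite !subdisc_pt ?node_d// exprSr; ring.
have EK j : modc (E j) <= K2 * modc (om - 1) ^+ 2.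
  have := quadratic_remainder (node j s) (node j.+1 s) fD fK2.
  move=> /le_trans; apply; rewrite ler_wpM2l// lerXn2r ?nnegrE ?modc_ge0//.
  rewrite nodeB modcM -[leRHS]mul1r ler_wpM2r ?modc_ge0// modcM.
  rewrite mulr_ile1 ?modc_ge0 ?disc_modc//.
  exact: le_trans (node_d j) d1.
suff -> : (om ^+ k - 1) * circle_avg s - (om - 1) * (set_val s * circle_avg' s) =
    N%:R^-1 * \sum_(j < N) (om ^+ j) ^- k * E j by exact: modc_avg.
have shift : \sum_(j < N) (om ^+ j) ^- k * f (node j.+1 s) =
    om ^+ k * \sum_(j < N) (om ^+ j) ^- k * f (node j s).
  pose G j := (om ^+ j) ^- k * f (node j s).
  have -> : \sum_(j < N) (om ^+ j) ^- k * f (node j.+1 s) = om ^+ k * \sum_(j < N) G j.+1.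
    rewrite mulr_sumr; apply: eq_bigr => j _; rewrite /G exprS exprMn invfM.
    by rewrite !mulrA divff ?mul1r// expf_neq0.
  congr (_ * _); have GN : G N = G 0%N by rewrite /G /node omN.
  have : \sum_(j < N.+1) G j = \sum_(j < N) G j + G N by rewrite big_ord_recr.
  rewrite big_ord_recl /= GN addrC => /addIr <-.
  by apply: eq_bigr.
rewrite /circle_avg /circle_avg'.
have -> : \sum_(j < N) (om ^+ j) ^- k * E j =
    \sum_(j < N) (om ^+ j) ^- k * f (node j.+1 s) -
    \sum_(j < N) (om ^+ j) ^- k * f (node j s) -
    (om - 1) * (set_val s * \sum_(j < N) (om ^+ j) ^- k * (cderiv f (node j s) * (D * om ^+ j))).
  rewrite -sumrB !mulr_sumr -sumrB; apply: eq_bigr => j _.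
  by rewrite /E nodeB; ring.
by rewrite shift; ring.
Qed.

Lemma modc_circle_avg s : modc (circle_avg s) <= B.
Proof. by apply: (modc_avg (F := fun j => f (node j s))) => j; exact: fB. Qed.

Hypothesis (om_neq1 : forall i, (0 < i <= k.+1)%N -> om ^+ i != 1).

Let om_sub1 : om - 1 != 0.
Proof. by rewrite subr_eq0 -[om]expr1 om_neq1. Qed.

(** In the limit of large N the average is homogeneous of degree k: this is
    Euler's equation up to an error of the order of the mesh. *)
Lemma circle_avg_euler s :
  modc (set_val s * circle_avg' s - k%:R * circle_avg s) <=
  (K2 + k%:R ^+ 2 * B) * modc (om - 1).
Proof.
set q := \sum_(i < k) om ^+ i.
have om0 : 0 < modc (om - 1) by rewrite modc_gt0.
have B0 : 0 <= B by apply: le_trans (fB s); rewrite modc_ge0.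
have -> : set_val s * circle_avg' s - k%:R * circle_avg s =
    - (q * circle_avg s - set_val s * circle_avg' s) + (q - k%:R) * circle_avg s by ring.
apply: le_trans (modcD _ _) _; rewrite modcN [leRHS]mulrDl; apply: lerD.
  rewrite -(ler_pM2r om0) -modcM -mulrA -expr2 mulrBl.
  have := summation_by_parts s; rewrite subrX1 -/q.
  by congr (modc _ <= _); ring.
rewrite modcM mulrAC ler_pM ?modc_ge0 ?modc_circle_avg//.
have -> : q - k%:R = \sum_(i < k) (om ^+ i - 1) by rewrite sumrB sumr_const card_ord.
apply: le_trans (modc_sum _ _ _) _.
apply: le_trans (_ : _ <= \sum_(i < k) k%:R * modc (om - 1)) _.
  apply: ler_sum => i _; apply: le_trans (modc_expr_sub1 _ om1) _.
  by rewrite ler_wpM2r ?modc_ge0// ler_nat ltnW.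
by rewrite sumr_const card_ord expr2 -[leLHS]mulr_natl mulrA.
Qed.

Variable e : R.
Hypotheses (e0 : 0 < e) (e1 : e <= 1).

Let pt (t : R) : disc := disc_pt t%:C%C.

Let ptK t : 0 <= t <= 1 -> set_val (pt t) = t%:C%C.
Proof. by move=> /andP[t0 t1]; rewrite disc_ptK// modc_real ger0_norm. Qed.

Let e01 : 0 <= e <= 1. Proof. by rewrite (ltW e0). Qed.

(** Euler's equation is integrated along the radius from [e] to 1, where the
    derivative of [s^-k * circle_avg s] is small. *)
Lemma circle_avg_homogeneous :
  modc (circle_avg (pt 1) - circle_avg (pt e) / e%:C%C ^+ k) <=
  e ^- k.+1 * ((K2 + k%:R ^+ 2 * B) * modc (om - 1)).
Proof.
pose G (s : disc) := circle_avg s * (set_val s ^+ k)^-1.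
pose dG (s : disc) := set_val s ^- k.+1 * (set_val s * circle_avg' s - k%:R * circle_avg s).
set C := _ * modc (om - 1).
have C0 : 0 <= C by apply: le_trans (circle_avg_euler (pt 1)); rewrite modc_ge0.
have segE t : exists2 r, e <= r & set_val (seg (pt e) (pt 1) t) = r%:C%C.
  rewrite seg_clamp !ptK// ?ler01 ?lexx// -rmorphB -rmorphM -rmorphD.
  eexists; last by reflexivity.
  by rewrite lerDl mulr_ge0 ?subr_ge0// le_max lexx.
have seg_ge t : e <= modc (set_val (seg (pt e) (pt 1) t)).
  by have [r er ->] := segE t; rewrite modc_real (le_trans er)// ler_norm.
have seg_neq0 t : set_val (seg (pt e) (pt 1) t) != 0.
  by rewrite -modc_gt0; apply: lt_le_trans e0 _.
have Gd t : has_cderiv G (seg (pt e) (pt 1) t) (dG (seg (pt e) (pt 1) t)).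
  set s := seg _ _ t; have s0 : set_val s != 0 := seg_neq0 t.
  have -> : dG s = circle_avg' s * (set_val s ^+ k)^-1 +
      circle_avg s * (- (set_val s ^+ k) ^- 2 * (k%:R * set_val s ^+ k.-1 * 1)).
    rewrite /dG; case: (k) => [|m] /=; first by rewrite expr1 expr0; field.
    by rewrite -(natr1 m) !exprS; field; rewrite expf_neq0.
  apply: has_cderivM; first exact: has_cderiv_circle_avg.
  apply: has_cderivV; first exact: expf_neq0.
  by apply: has_cderivX; exact: has_cderiv_id.
have dGK t : modc (dG (seg (pt e) (pt 1) t)) <= e ^- k.+1 * C.
  rewrite /dG modcM modcV modcX ler_pM ?modc_ge0 ?invr_ge0 ?exprn_ge0 ?modc_ge0//.
    rewrite lef_pV2 ?posrE ?exprn_gt0// ?modc_gt0 ?seg_neq0//.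
    by rewrite lerXn2r ?nnegrE ?modc_ge0 ?(ltW e0)// seg_ge.
  exact: circle_avg_euler.
have := mean_value_segment Gd (fun t _ => dGK t).
rewrite /G !ptK ?ler01 ?lexx// rmorph1 expr1n invr1 mulr1 => /le_trans; apply.
rewrite -[leRHS]mulr1; apply: ler_wpM2l.
  by apply: mulr_ge0 => //; rewrite invr_ge0 exprn_ge0// ltW.
have -> : 1 - e%:C%C = (1 - e)%:C%C :> R[i] by rewrite rmorphB rmorph1.
rewrite modc_real ger0_norm ?subr_ge0//.
by rewrite gerBl ltW.
Qed.

Variable K : R.
Hypotheses (fK : forall a, modc (cderivn k.+1 f a) <= K).

(** Averaging the Taylor polynomial of [f] at [x] over the roots of unity keeps
    its term of degree [k] only. *)
Lemma circle_avg_near0 :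
  modc (circle_avg (pt e) / e%:C%C ^+ k - cderivn k f (disc_pt x) / k`!%:R * D ^+ k) <= K * e.
Proof.
pose c m := cderivn m f (disc_pt x) / m`!%:R.
pose E j := f (node j (pt e)) - taylor k.+1 f (disc_pt x) (set_val (node j (pt e))).
have d1 : d <= 1 by apply: le_trans xd; rewrite lerDr modc_ge0.
have K0 : 0 <= K by apply: le_trans (fK (pt e)); rewrite modc_ge0.
have xK : set_val (disc_pt x) = x.
  by apply: disc_ptK; apply: le_trans xd; rewrite lerDl.
have nodeE j : set_val (node j (pt e)) - set_val (disc_pt x) = D * om ^+ j * e%:C%C.
  by rewrite subdisc_pt ?node_d// xK addrC addKr ptK.
have EK j : modc (E j) <= K * e ^+ k.+1.
  have := taylor_remainder (disc_pt x) (node j (pt e)) fD fK.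
  move=> /le_trans; apply; rewrite ler_wpM2l// lerXn2r ?nnegrE ?modc_ge0 ?(ltW e0)//.
  rewrite nodeE modcM modc_real (gtr0_norm e0) -[leRHS]mul1r ler_wpM2r ?(ltW e0)//.
  exact: le_trans (node_d j) d1.
have e00 : e%:C%C ^+ k != 0 :> R[i].
  by rewrite expf_neq0// -modc_gt0 modc_real gtr0_norm.
have avgE : circle_avg (pt e) = c k * D ^+ k * e%:C%C ^+ k +
    N%:R^-1 * \sum_(j < N) (om ^+ j) ^- k * E j.
  rewrite /circle_avg.
  have -> : \sum_(j < N) (om ^+ j) ^- k * f (node j (pt e)) =
      \sum_(j < N) (om ^+ j) ^- k * taylor k.+1 f (disc_pt x) (set_val (node j (pt e))) +
      \sum_(j < N) (om ^+ j) ^- k * E j.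
    by rewrite -big_split; apply: eq_bigr => j _ /=; rewrite /E; ring.
  rewrite mulrDr; congr (_ + _).
  have -> : \sum_(j < N) (om ^+ j) ^- k * taylor k.+1 f (disc_pt x) (set_val (node j (pt e))) =
      \sum_(m < k.+1) c m * (D * e%:C%C) ^+ m * \sum_(j < N) (om ^+ j) ^- k * (om ^+ j) ^+ m.
    under eq_bigr do rewrite /taylor mulr_sumr.
    rewrite exchange_big; apply: eq_bigr => m _ /=; rewrite mulr_sumr.
    by apply: eq_bigr => j _; rewrite nodeE /c !exprMn; ring.
  rewrite big_ord_recr /= big1 ?add0r; last first.
    move=> m _; rewrite (_ : \sum_(j < N) _ = 0) ?mulr0//.
    rewrite -[RHS](@sum_root_of_unity _ (om ^- (k - m)) N).
    - apply: eq_bigr => j _; rewrite [RHS]exprVn -!exprM.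
      have jm : (j * m <= j * k)%N by rewrite leq_mul2l orbC ltnW.
      rewrite -[X in (om ^+ X)^-1](subnK jm) exprD invfM.
      by rewrite -mulrA mulVf ?expf_neq0// mulr1 -mulnBr mulnC.
    - by rewrite exprVn -exprM mulnC exprM omN expr1n invr1.
    - by rewrite invr_eq1 om_neq1// subn_gt0 ltn_ord/= leqW// leq_subr.
  rewrite (eq_bigr (fun=> 1)); last by move=> j _; rewrite mulVf// expf_neq0// expf_neq0.
  by rewrite sumr_const card_ord exprMn; field.
rewrite -/(c k) avgE.
have -> : (c k * D ^+ k * e%:C%C ^+ k + N%:R^-1 * \sum_(j < N) (om ^+ j) ^- k * E j) /
    e%:C%C ^+ k - c k * D ^+ k = (N%:R^-1 * \sum_(j < N) (om ^+ j) ^- k * E j) / e%:C%C ^+ k.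
  by rewrite mulrDl mulfK// [X in X - _]addrC addrK.
rewrite modcM modcV modcX modc_real (gtr0_norm e0).
rewrite ler_pdivrMr ?exprn_gt0// -mulrA -exprS.
exact: modc_avg.
Qed.

End CauchyEstimate.

(** Cauchy's estimate. The circle averages are compared on the circle of radius
    [d] and on an infinitesimal one. *)
Theorem cauchy_estimate (R : realType) (f : closed_disc R -> R[i]) (x : R[i])
    (d B K2 K : R) (k : nat) : Dinfty f -> 0 <= d -> modc x + d <= 1 ->
  (forall a, modc (f a) <= B) -> (forall a, modc (cderivn 2 f a) <= K2) ->
  (forall a, modc (cderivn k.+1 f a) <= K) ->
  modc (cderivn k f (disc_pt x)) * d ^+ k <= k`!%:R * B.
Proof.
move=> fD d0 xd fB fK2 fK.
have B0 : 0 <= B by apply: le_trans (fB (disc_pt x)); rewrite modc_ge0.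
have K20 : 0 <= K2 by apply: le_trans (fK2 (disc_pt x)); rewrite modc_ge0.
have K0 : 0 <= K by apply: le_trans (fK (disc_pt x)); rewrite modc_ge0.
have kf0 : 0 < k`!%:R :> R by rewrite ltr0n fact_gt0.
rewrite -ler_pdivrMl//.
set T := (X in X <= _).
have TE : T = modc (cderivn k f (disc_pt x) / k`!%:R * d%:C%C ^+ k).
  by rewrite /T !modcM modcV modc_nat modcX modc_real ger0_norm// mulrCA mulrA.
apply/ler_addgt0Pr => e' e'0.
pose e := Num.min 1 (e' / (K + 1)).
have K1 : 0 < K + 1 by rewrite ltr_wpDl.
have e0 : 0 < e by rewrite lt_min ltr01 divr_gt0.
have e1 : e <= 1 by rewrite ge_min lexx.
pose C := K2 + k%:R ^+ 2 * B.
have C0 : 0 <= C by rewrite addr_ge0// mulr_ge0// exprn_ge0.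
have C1 : 0 < C + 1 by rewrite ltr_wpDl.
have m0 : 0 < e ^+ k.+2 / (C + 1) by rewrite divr_gt0// exprn_gt0.
have [N [om [N0 omN om1 om_small om_neq1]]] := root_of_unity_near1 k.+1 m0.
pose A := circle_avg f x d k N om.
have near1 : modc (A (disc_pt 1%:C%C)) <= B by exact: modc_circle_avg.
have hom := circle_avg_homogeneous fD d0 xd fB fK2 N0 omN om1 om_neq1 e0 e1.
have near0 := circle_avg_near0 fD d0 xd N0 omN om1 om_neq1 e0 e1 fK.
rewrite -/A in hom near0; rewrite TE.
set v := _ * d%:C%C ^+ k.
have -> : v = A (disc_pt 1%:C%C) - (A (disc_pt 1%:C%C) - A (disc_pt e%:C%C) / e%:C%C ^+ k) -
    (A (disc_pt e%:C%C) / e%:C%C ^+ k - v) by ring.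
apply: le_trans (modcD _ _) _; rewrite modcN.
apply: le_trans (lerD (modcD _ _) near0) _; rewrite modcN.
rewrite -addrA; apply: lerD => //.
have homC : e ^- k.+1 * (C * modc (om - 1)) <= e.
  rewrite ler_pdivrMl ?exprn_gt0// -exprSr.
  apply: le_trans (_ : (C + 1) * (e ^+ k.+2 / (C + 1)) <= _).
    by apply: ler_pM; rewrite ?modc_ge0// ?(ltW om_small)// lerDl.
  by rewrite mulrC divfK// gt_eqF.
apply: le_trans (lerD (le_trans hom homC) (lexx _)) _.
have : e <= e' / (K + 1) by rewrite ge_min lexx orbT.
rewrite ler_pdivlMr//; lra.
Qed.

(** * Majorants for the derivatives of a composite *)

Section NonnegPoly.
Context {R : realType}.
Implicit Types (p q : {poly R}).

Definition nneg_coef p := forall k, 0 <= p`_k.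

Lemma nneg_coefX p m : nneg_coef p -> nneg_coef (p ^+ m).
Proof.
move=> p0; elim: m => [|m IHm] k; first by rewrite expr0 coef1 ler0n.
by rewrite exprS coefM sumr_ge0// => i _; rewrite mulr_ge0.
Qed.

Lemma nneg_horner_ge0 p e : nneg_coef p -> 0 <= e -> 0 <= p.[e].
Proof.
by move=> p0 e0; rewrite horner_coef sumr_ge0// => i _; rewrite mulr_ge0// exprn_ge0.
Qed.

Lemma sum_coef_le_horner p e L : nneg_coef p -> 0 <= e ->
  \sum_(n < L) p`_n * e ^+ n <= p.[e].
Proof.
move=> p0 e0; rewrite (@horner_coef_wide _ (maxn L (size p))) ?leq_maxr//.
rewrite (big_ord_widen _ (fun n => p`_n * e ^+ n) (leq_maxl L (size p))).
by rewrite big_mkcond ler_sum// => i _; case: ifP => // _; rewrite mulr_ge0// exprn_ge0.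
Qed.

Lemma coef_le_horner p e n : nneg_coef p -> 0 <= e -> p`_n * e ^+ n <= p.[e].
Proof.
move=> p0 e0; apply: le_trans (sum_coef_le_horner n.+1 p0 e0).
by rewrite big_ord_recr /= lerDr sumr_ge0// => i _; rewrite mulr_ge0// exprn_ge0.
Qed.

End NonnegPoly.

(** A derivative of a composite is dominated by the corresponding coefficient
    of a composition of power series: it suffices to dominate the Taylor
    coefficients of the inner map at the point by those of a polynomial. *)
Lemma comp_majorant (R : realType) (X Y : planeSet R) (f : X -> R[i]) (h : Y -> X)
    (b : Y) (p : {poly R}) n :
  Dinfty f -> Dinfty (set_val \o h) -> nneg_coef p ->
  (forall k, (0 < k <= n)%N -> modc (cderivn k (set_val \o h) b) <= k`!%:R * p`_k) ->
  modc (cderivn n (f \o h) b) <=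
  n`!%:R * \sum_(m < n.+1) modc (cderivn m f (h b)) / m`!%:R * (p ^+ m)`_n.
Proof.
move=> fD hD p0; elim/ltn_ind: n f fD => -[_ f fD _|n IHn f fD hp].
  by rewrite big_ord1 fact0 mul1r expr0 coef1 eqxx mulr1 divr1.
have f'D : Dinfty (cderiv f) by exact: (@Dinfty_cderivn _ _ 1).
pose a m := modc (cderivn m.+1 f (h b)) / m`!%:R.
have a0 m : 0 <= a m by rewrite divr_ge0 ?modc_ge0.
have pm0 m k : 0 <= (p ^+ m)`_k by exact: nneg_coefX.
rewrite cderivn_compS//.
apply: le_trans (_ : _ <= n`!%:R * \sum_(m < n.+1) a m * (p^`() * p ^+ m)`_n) _.
  apply: le_trans (modc_sum _ _ _) _.
  have -> : n`!%:R * \sum_(m < n.+1) a m * (p^`() * p ^+ m)`_n =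
      \sum_(k < n.+1) n`!%:R * (k.+1%:R * p`_k.+1) * \sum_(m < n.+1) a m * (p ^+ m)`_(n - k).
    rewrite mulr_sumr; under eq_bigr do rewrite coefM !mulr_sumr.
    rewrite exchange_big; apply: eq_bigr => k _ /=.
    rewrite mulr_sumr; apply: eq_bigr => m _.
    by rewrite coef_deriv -mulr_natl; ring.
  apply: ler_sum => k _; have kn : (k <= n)%N by rewrite -ltnS.
  rewrite modcM modc_nat modcM.
  apply: le_trans (_ : _ <= 'C(n, k)%:R * ((n - k)`!%:R *
     \sum_(m < n.+1) a m * (p ^+ m)`_(n - k) * (k.+1`!%:R * p`_k.+1))) _.
    rewrite ler_wpM2l// -mulr_suml mulrA; apply: ler_pM; rewrite ?modc_ge0//.
      apply: le_trans (IHn (n - k)%N _ _ f'D _) _.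
      - by rewrite ltnS leq_subr.
      - move=> j /andP[j0 jk]; apply: hp; rewrite j0 (leq_trans jk)//.
        by rewrite (leq_trans (leq_subr _ _)).
      rewrite ler_wpM2l//.
      under [leLHS]eq_bigr do rewrite -cderivnS.
      have nk : ((n - k).+1 <= n.+1)%N by rewrite ltnS leq_subr.
      rewrite (big_ord_widen _ (fun m => a m * (p ^+ m)`_(n - k)) nk) big_mkcond.
      by apply: ler_sum => m _; case: ifP => // _; rewrite mulr_ge0.
    exact: hp.
  rewrite -mulr_suml -(bin_fact kn) factS !natrM.
  by rewrite le_eqVlt; apply/orP; left; apply/eqP; ring.
rewrite [X in _ <= _ * X]big_ord_recl mulrDr -[leLHS]add0r.
apply: lerD; first by rewrite !mulr_ge0// ?divr_ge0 ?modc_ge0// pm0.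
rewrite !mulr_sumr; apply: ler_sum => m _; rewrite /= /bump /= add1n.
have : n.+1%:R * (p ^+ m.+1)`_n.+1 = m.+1%:R * (p^`() * p ^+ m)`_n.
  by rewrite !mulr_natl -coef_deriv deriv_exp coefMn.
have m0 : m.+1%:R != 0 :> R by rewrite pnatr_eq0.
have mf0 : m`!%:R != 0 :> R by rewrite pnatr_eq0 -lt0n fact_gt0.
rewrite /a !factS !natrM => pE.
rewrite le_eqVlt; apply/orP; left; apply/eqP.
rewrite (_ : (p^`() * p ^+ m)`_n = n.+1%:R * (p ^+ m.+1)`_n.+1 / m.+1%:R).
  move: m0 mf0; move: (m.+1%:R : R) (m`!%:R : R) => u v u0 v0.
  by field; rewrite u0 v0.
by rewrite pE mulrAC divff// mul1r.
Qed.

(** * Non-analytic weights and the composition estimate *)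

Section Weights.
Context {R : realType} (M : weightSeq R).

Lemma weight_ratio_gt0 n : 0 < n`!%:R / M n.
Proof. by rewrite divr_gt0 ?weightSeq_gt0// ltr0n fact_gt0. Qed.

Lemma weight_ratio_submult m n : (m <= n)%N ->
  n`!%:R / M n <= m`!%:R / M m * ((n - m)`!%:R / M (n - m)%N).
Proof.
move=> mn; have := weightSeq_bin M (n - m)%N m; rewrite subnKC// -(bin_fact mn) !natrM.
have Mn := weightSeq_gt0 M n; have Mm := weightSeq_gt0 M m.
have Mnm := weightSeq_gt0 M (n - m)%N.
rewrite ler_pdivlMr ?mulr_gt0// => bM.
rewrite ler_pdivrMr// mulf_div mulrAC ler_pdivlMr ?mulr_gt0//.
rewrite mulrAC [leRHS]mulrC; apply: ler_wpM2r => //.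
Qed.

Lemma non_analytic_bound (e : R) : non_analytic M -> 0 < e ->
  exists2 A, 0 < A & forall n, n`!%:R / M n <= A * e ^+ n.
Proof.
move=> hM e0; have /cvgrPdist_lt/(_ _ e0)[N _ NP] := hM.
have ratio0 n : 0 <= n`!%:R / M n / e ^+ n.
  by rewrite divr_ge0 ?exprn_ge0 ?ltW// weight_ratio_gt0.
have S0 : 0 <= \sum_(i < N.+1) i`!%:R / M i / e ^+ i by exact: sumr_ge0.
exists (1 + \sum_(i < N.+1) i`!%:R / M i / e ^+ i); first by rewrite ltr_wpDr.
move=> n; rewrite -ler_pdivrMr ?exprn_gt0//.
have [nN|Nn] := ltnP n N.+1.
  rewrite (bigD1 (Ordinal nN)) //= addrCA lerDl addr_ge0// sumr_ge0//.
apply: le_trans (_ : 1 <= _); last by rewrite lerDl.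
rewrite ler_pdivrMr ?exprn_gt0// mul1r.
have := NP n (ltnW Nn); rewrite /= sub0r normrN ger0_norm ?powR_ge0// => xe.
have n0 : n%:R != 0 :> R by rewrite pnatr_eq0; case: n Nn {xe}.
have -> : n`!%:R / M n = ((n`!%:R / M n) `^ n%:R^-1) ^+ n.
  by rewrite -powR_mulrn ?powR_ge0// -powRrM mulVf// powRr1// ltW// weight_ratio_gt0.
by rewrite lerXn2r ?nnegrE ?powR_ge0 ?(ltW e0)// ltW.
Qed.

Lemma sum_geom_le2 (x : R) N : 0 <= x <= 1 / 2 -> \sum_(k < N) x ^+ k <= 2.
Proof.
move=> /andP[x0 x2]; have := subrX1 x N.
have : 0 <= x ^+ N by rewrite exprn_ge0.
have : 0 <= \sum_(k < N) x ^+ k by rewrite sumr_ge0// => i _; rewrite exprn_ge0.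
move: (x ^+ N) (\sum_(k < N) _) => u v; nra.
Qed.

(** The part of a composite where the inner derivative is small. Since
    [n!/M n] is submultiplicative, the order [m] of the outer derivative can be
    split off, and what remains is summed by evaluating a polynomial at [e]. *)
Lemma majorant_sum_contraction (S : nat -> R) (r : {poly R}) (A e : R) L :
  (forall m, 0 <= S m) -> nneg_coef r -> 0 < e -> 0 <= A ->
  (forall j, j`!%:R / M j <= A * e ^+ j) ->
  \sum_(n < L) n`!%:R * (\sum_(m < n.+1) S m / m`!%:R * ((r * 'X) ^+ m)`_n) / M n <=
  A * \sum_(m < L) r.[e] ^+ m * (S m / M m).
Proof.
move=> S0 r0 e0 A0 Ae.
have p0 : nneg_coef (r * 'X) by move=> k; rewrite coefMX; case: ifP.
have pm0 m k : 0 <= ((r * 'X) ^+ m)`_k by exact: nneg_coefX.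
have pm_small m n : (n < m)%N -> ((r * 'X) ^+ m)`_n = 0.
  by move=> nm; rewrite exprMn coefMXn nm.
have -> : \sum_(n < L) n`!%:R * (\sum_(m < n.+1) S m / m`!%:R * ((r * 'X) ^+ m)`_n) / M n =
    \sum_(m < L) S m / m`!%:R * \sum_(n < L) n`!%:R / M n * ((r * 'X) ^+ m)`_n.
  under [RHS]eq_bigr do rewrite mulr_sumr.
  rewrite exchange_big; apply: eq_bigr => n _ /=.
  rewrite (big_ord_widen _ (fun m => S m / m`!%:R * ((r * 'X) ^+ m)`_n) (ltn_ord n)).
  rewrite big_mkcond mulrAC mulr_sumr; apply: eq_bigr => m _.
  by case: ltnP => [_|/pm_small ->]; ring.
rewrite mulr_sumr; apply: ler_sum => m _.
have mf0 : 0 < m`!%:R :> R by rewrite ltr0n fact_gt0.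
apply: le_trans (_ : _ <= S m / m`!%:R * (m`!%:R / M m * A * r.[e] ^+ m)) _; last first.
  rewrite le_eqVlt; apply/orP; left; apply/eqP; field.
  by rewrite !gt_eqF ?weightSeq_gt0.
apply: ler_wpM2l; first by rewrite divr_ge0// ltW.
apply: le_trans (_ : _ <= \sum_(n < L) m`!%:R / M m * A / e ^+ m *
   (((r * 'X) ^+ m)`_n * e ^+ n)) _.
  apply: ler_sum => n _; have [mn|nm] := leqP m n; last by rewrite pm_small// mulr0 mul0r mulr0.
  rewrite [X in _ <= _ * X]mulrC mulrA; apply: ler_wpM2r => //.
  apply: le_trans (weight_ratio_submult mn) _.
  rewrite -!mulrA; apply: ler_wpM2l => //.
  apply: ler_wpM2l; first by rewrite invr_ge0 ltW// weightSeq_gt0.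
  apply: le_trans (Ae _) _; rewrite ler_wpM2l//.
  by rewrite -{2}(subnKC mn) exprD mulrA mulVf ?mul1r// expf_neq0// gt_eqF.
rewrite -mulr_sumr.
have := sum_coef_le_horner L (nneg_coefX m p0) (ltW e0).
rewrite horner_exp hornerM hornerX [leRHS]exprMn => H.
have em0 : 0 < e ^+ m by rewrite exprn_gt0.
apply: le_trans (_ : _ <= m`!%:R / M m * A / e ^+ m * (r.[e] ^+ m * e ^+ m)) _.
  apply: ler_wpM2l => //; apply: divr_ge0; last exact: ltW.
  by apply: mulr_ge0 => //; rewrite ltW// weight_ratio_gt0.
by rewrite [r.[e] ^+ m * _]mulrC mulrA divfK ?gt_eqF.
Qed.

(** The part of a composite whose inner values stay at distance [d] from the
    circle: Cauchy's estimate makes the majorant an analytic function, and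
    non-analytic weights sum its coefficients. *)
Lemma majorant_sum_inner (p : {poly R}) (A B d e : R) L :
  nneg_coef p -> 0 < e -> 0 <= A -> 0 <= B -> 0 < d -> p.[e] <= d / 2 ->
  (forall j, j`!%:R / M j <= A * (e / 2) ^+ j) ->
  \sum_(n < L) n`!%:R * (\sum_(m < n.+1) B / d ^+ m * (p ^+ m)`_n) / M n <= 4 * A * B.
Proof.
move=> p0 e0 A0 B0 d0 pe Ae.
have pe0 : 0 <= p.[e] by exact: nneg_horner_ge0 (ltW e0).
have inner n : \sum_(m < n.+1) B / d ^+ m * (p ^+ m)`_n <= 2 * B / e ^+ n.
  rewrite ler_pdivlMr ?exprn_gt0// mulr_suml.
  apply: le_trans (_ : \sum_(m < n.+1) B * (p.[e] / d) ^+ m <= _).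
    apply: ler_sum => m _; rewrite -!mulrA; apply: ler_wpM2l => //.
    rewrite expr_div_n mulrC ler_wpM2r ?invr_ge0 ?exprn_ge0 ?(ltW d0)//.
    by rewrite -horner_exp coef_le_horner ?(ltW e0)//; exact: nneg_coefX.
  rewrite -mulr_sumr mulrC; apply: ler_wpM2r => //; apply: sum_geom_le2.
  by rewrite divr_ge0 ?(ltW d0)//= ler_pdivrMr// mulrC mul1r.
apply: le_trans (_ : \sum_(n < L) 2 * A * B * (1 / 2) ^+ n <= _).
  apply: ler_sum => n _; rewrite mulrAC.
  apply: le_trans (_ : _ <= A * (e / 2) ^+ n * (2 * B / e ^+ n)) _.
    apply: ler_pM (inner n) => //; first by rewrite ltW// weight_ratio_gt0.
    apply: sumr_ge0 => m _; rewrite mulr_ge0 ?divr_ge0 ?exprn_ge0 ?(ltW d0)//.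
    exact: nneg_coefX.
  rewrite le_eqVlt; apply/orP; left; apply/eqP.
  rewrite !expr_div_n expr1n; field.
  by rewrite !expf_neq0// gt_eqF.
rewrite -mulr_sumr.
apply: le_trans (_ : _ <= 2 * A * B * 2) _; last by rewrite le_eqVlt; apply/orP; left; apply/eqP; ring.
by apply: ler_wpM2l; [rewrite !mulr_ge0|apply: sum_geom_le2; lra].
Qed.

End Weights.

Section CompositionEstimate.
Context {R : realType} (M : weightSeq R).
Notation disc := (closed_disc R).
Variables (phi : disc -> disc) (C d : R).
Hypotheses (hM : non_analytic M) (phiD : Dinfty (set_val \o phi)).
Hypothesis (phiC : forall k a, (0 < k)%N ->
  modc (cderivn k (set_val \o phi) a) <= k`!%:R * C ^+ k).
Hypotheses (C1 : 1 <= C) (d01 : 0 < d <= 1).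
Hypothesis (phid : forall a, modc (set_val (phi a)) <= 1 - d \/
  modc (cderiv (set_val \o phi) a) <= 1 - d).

Let C0 : 0 < C. Proof. exact: lt_le_trans C1. Qed.
Let d0 : 0 < d. Proof. by case/andP: d01. Qed.
Let d1 : 0 <= 1 - d. Proof. by rewrite subr_ge0; case/andP: d01. Qed.

(* Shifted by one degree, these polynomials dominate the Taylor coefficients of
   phi: with the geometric bound only, or with the bound 1 - d on phi'. *)
Let tail (N : nat) : {poly R} := \poly_(k < N) C ^+ k.+1.
Let contr (N : nat) : {poly R} := \poly_(k < N) (if k == 0%N then 1 - d else C ^+ k.+1).

Let tail_ge0 N : nneg_coef (tail N).
Proof. by move=> k; rewrite coef_poly; case: ifP => // _; rewrite exprn_ge0 ?ltW. Qed.

Let contr_ge0 N : nneg_coef (contr N).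
Proof.
by move=> k; rewrite coef_poly; case: ifP => // _; case: ifP => // _; rewrite exprn_ge0 ?ltW.
Qed.

Let tail_eval N e : 0 <= e -> C * e <= 1 / 2 -> (tail N).[e] <= C * 2.
Proof.
move=> e0 Ce; rewrite horner_poly.
rewrite (eq_bigr (fun k : 'I_N => C * (C * e) ^+ k)); last first.
  by move=> k _; rewrite exprS exprMn mulrA.
rewrite -mulr_sumr; apply: ler_wpM2l; first exact: ltW.
by apply: sum_geom_le2; rewrite Ce mulr_ge0 ?(ltW C0).
Qed.

Let contr_eval N e : 0 <= e -> C * e <= 1 / 2 ->
  (contr N).[e] <= 1 - d + 2 * C ^+ 2 * e.
Proof.
move=> e0 Ce; rewrite horner_poly.
have b0 : 0 <= 2 * C ^+ 2 * e by rewrite !mulr_ge0 ?exprn_ge0 ?(ltW C0).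
case: N => [|N]; first by rewrite big_ord0 addr_ge0.
rewrite big_ord_recl /= expr0 mulr1 lerD2l.
rewrite (eq_bigr (fun k : 'I_N => C ^+ 2 * e * (C * e) ^+ k)); last first.
  by move=> k _; rewrite /bump /= add1n !exprS exprMn; ring.
rewrite -mulr_sumr -[leRHS]mulrA [leRHS]mulrC; apply: ler_wpM2l.
  by rewrite mulr_ge0 ?exprn_ge0 ?(ltW C0).
by apply: sum_geom_le2; rewrite Ce mulr_ge0 ?(ltW C0).
Qed.

(** Composition with [phi] is bounded even for the weaker norms obtained by
    damping the [m]-th derivative by the factor [rho ^ m]; the gain is what
    makes the operator compact. *)
Lemma composition_estimate : exists K rho : R, [/\ 0 <= K, 0 <= rho < 1 &
  forall (f : disc -> R[i]) (S : nat -> R) L, Dinfty f ->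
    (forall m a, modc (cderivn m f a) <= S m) ->
    exists2 W : nat -> R,
      (forall n a, (n < L)%N -> modc (cderivn n (f \o phi) a) <= W n) &
      \sum_(n < L) W n / M n <= K * \sum_(m < L.+1) rho ^+ m * (S m / M m)].
Proof.
(* Radius for the contracting part: there 2 C^2 e uses up half of the gap d. *)
pose e1 := Num.min (1 / 2 / C) (d / 2 / (2 * C ^+ 2)).
have CC0 : 0 < 2 * C ^+ 2 by rewrite mulr_gt0 ?exprn_gt0.
have e10 : 0 < e1 by rewrite lt_min !divr_gt0.
have Ce1 : C * e1 <= 1 / 2 by rewrite mulrC -ler_pdivlMr// ge_min lexx.
have e1d : 2 * C ^+ 2 * e1 <= d / 2 by rewrite [leLHS]mulrC -ler_pdivlMr// ge_min lexx orbT.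
(* Radius for the inner part: there 2 C e is at most half of the distance d. *)
pose e2 := Num.min (1 / 2 / C) (d / 2 / (2 * C)).
have e20 : 0 < e2 by rewrite lt_min !divr_gt0// mulr_gt0.
have Ce2 : C * e2 <= 1 / 2 by rewrite mulrC -ler_pdivlMr// ge_min lexx.
have e2d : C * 2 * e2 <= d / 2.
  by rewrite [C * 2]mulrC [leLHS]mulrC -ler_pdivlMr ?mulr_gt0// ge_min lexx orbT.
have [A1 A10 A1P] := non_analytic_bound hM e10.
have [A2 A20 A2P] := non_analytic_bound hM (divr_gt0 e20 (ltr0n R 2)).
pose rho := 1 - d / 2.
have rho01 : 0 <= rho < 1.
  by have /andP[? ?] := d01; rewrite /rho; apply/andP; split; lra.
exists (A1 + 4 * A2), rho; split => //.
  by apply: addr_ge0; [exact: ltW|apply: mulr_ge0 => //; exact: ltW].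
move=> f S L fD fS.
pose b : disc := disc_pt 0.
have S0 m : 0 <= S m by apply: le_trans (fS m b); rewrite modc_ge0.
pose V n := n`!%:R * (\sum_(m < n.+1) S m / m`!%:R * ((contr L * 'X) ^+ m)`_n).
pose U n := n`!%:R * (\sum_(m < n.+1) S 0%N / d ^+ m * ((tail L * 'X) ^+ m)`_n).
have tX0 : nneg_coef (tail L * 'X).
  by move=> k; rewrite coefMX; case: ifP => // _; exact: tail_ge0.
have sX0 : nneg_coef (contr L * 'X).
  by move=> k; rewrite coefMX; case: ifP => // _; exact: contr_ge0.
have V0 n : 0 <= V n.
  rewrite mulr_ge0 ?ler0n// sumr_ge0// => m _; rewrite mulr_ge0 ?divr_ge0//.
  exact: nneg_coefX.
have U0 n : 0 <= U n.
  rewrite mulr_ge0 ?ler0n// sumr_ge0// => m _; rewrite mulr_ge0 ?divr_ge0 ?exprn_ge0 ?(ltW d0)//.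
  exact: nneg_coefX.
exists (fun n => U n + V n) => [n a nL|].
  have [inn|stp] := phid a.
    apply: le_trans (_ : U n <= _); last by rewrite lerDl.
    apply: le_trans (comp_majorant fD phiD tX0 _) _ => [k /andP[k0 kn]|].
      rewrite coefMX coef_poly gtn_eqF//.
      have kL : (k.-1 < L)%N by rewrite prednK// (leq_trans kn)// ltnW.
      by rewrite kL prednK//; exact: phiC.
    apply: ler_wpM2l => //; apply: ler_sum => m _; apply: ler_wpM2r; first exact: nneg_coefX.
    have := @cauchy_estimate R f (set_val (phi a)) d (S 0%N) (S 2%N) (S m.+1) m fD (ltW d0).
    rewrite set_valK => /(_ _ (fS 0%N) (fS 2%N) (fS m.+1)) cauchy.
    rewrite ler_pdivrMr ?ltr0n ?fact_gt0// mulrAC ler_pdivlMr ?exprn_gt0// [leRHS]mulrC.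
    by apply: cauchy; rewrite -lerBrDr.
  apply: le_trans (_ : V n <= _); last by rewrite lerDr.
  apply: le_trans (comp_majorant fD phiD sX0 _) _ => [k /andP[k0 kn]|].
    rewrite coefMX coef_poly gtn_eqF//.
    have kL : (k.-1 < L)%N by rewrite prednK// (leq_trans kn)// ltnW.
    rewrite kL prednK//; have [k1|k1] := eqVneq k.-1 0%N; last exact: phiC.
    by rewrite -(prednK k0) k1 mul1r.
  apply: ler_wpM2l => //; apply: ler_sum => m _; apply: ler_wpM2r; first exact: nneg_coefX.
  by apply: ler_wpM2r (fS _ _); rewrite invr_ge0.
under eq_bigr do rewrite mulrDl.
rewrite big_split /= addrC mulrDl; apply: lerD.
  apply: le_trans (majorant_sum_contraction _ _ (contr_ge0 L) e10 (ltW A10) A1P) _ => //.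
  apply: ler_wpM2l; first exact: ltW.
  rewrite big_ord_recr /=; apply: ler_wpDr.
    by rewrite mulr_ge0 ?divr_ge0 ?exprn_ge0//; have /andP[] := rho01 => // *; exact/ltW/weightSeq_gt0.
  apply: ler_sum => m _; apply: ler_wpM2r; first by rewrite divr_ge0// ltW// weightSeq_gt0.
  have sr : (contr L).[e1] <= rho.
    by apply: le_trans (contr_eval _ (ltW e10) Ce1) _; rewrite /rho; lra.
  by rewrite lerXn2r ?nnegrE ?nneg_horner_ge0 ?(ltW e10)//; case/andP: rho01.
have te : (tail L * 'X).[e2] <= d / 2.
  rewrite hornerM hornerX; apply: le_trans e2d.
  by apply: ler_wpM2r; [exact: ltW|exact: tail_eval (ltW e20) Ce2].
apply: le_trans (majorant_sum_inner _ tX0 e20 (ltW A20) (S0 0%N) d0 te A2P) _.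
apply: ler_wpM2l; first by rewrite mulr_ge0 ?ltW.
rewrite big_ord_recl /= expr0 mul1r weightSeq_0 divr1 lerDl sumr_ge0// => m _.
by rewrite mulr_ge0 ?divr_ge0 ?exprn_ge0 ?(ltW (weightSeq_gt0 _ _))//; case/andP: rho01.
Qed.

End CompositionEstimate.

(** * Supremum norms, analytic maps and the uniform gap *)

Section SupNorms.
Context {R : realType} {X : planeSet R} (M : weightSeq R).
Implicit Types (f : X -> R[i]) (B : R).

Definition dsup n f : R := fine (supnorm (cderivn n f)).

Lemma dsup_ge0 n f : 0 <= dsup n f.
Proof. by rewrite fine_ge0// supnorm_ge0. Qed.

(** A single infinite term would make the sum infinite. *)
Lemma supnorm_fin_num n f : (ddnorm M f < +oo)%E ->
  supnorm (cderivn n f) \is a fin_num.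
Proof.
move=> nf.
have sup0 := supnorm_ge0 (cderivn n f).
rewrite ge0_fin_numE// ltNge leye_eq; apply/eqP => supy.
have := @nneseries_lim_ge R _ xpredT 0%N n.+1 (fun k _ _ => ddnorm_term_ge0 M f k).
rewrite -/(ddnorm M f) big_nat_recr//= supy gt0_mulye; last first.
  by rewrite lte_fin invr_gt0 weightSeq_gt0.
rewrite addey; last first.
  rewrite gt_eqF// (lt_le_trans ltNy0)// sume_ge0// => i _.
  exact: ddnorm_term_ge0.
by rewrite leye_eq => /eqP nfy; move: nf; rewrite nfy.
Qed.

Lemma dsup_ub n f a : (ddnorm M f < +oo)%E -> modc (cderivn n f a) <= dsup n f.
Proof.
by move=> nf; rewrite -lee_fin /dsup fineK ?supnorm_fin_num//; exact: supnorm_ub.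
Qed.

Lemma sum_dsup_le f L : (ddnorm M f < +oo)%E ->
  \sum_(n < L) dsup n f / M n <= fine (ddnorm M f).
Proof.
move=> nf; have f0 := ddnorm_ge0 M f.
rewrite -lee_fin fineK ?ge0_fin_numE//.
apply: le_trans (@nneseries_lim_ge R _ xpredT 0%N L (fun k _ _ => ddnorm_term_ge0 M f k)).
rewrite big_mkord -sumEFin; apply: lee_sum => n _.
rewrite EFinM; apply: lee_wpmul2r; first by rewrite lee_fin invr_ge0 ltW// weightSeq_gt0.
by rewrite /dsup fineK ?supnorm_fin_num.
Qed.

(** The bounds [W] may depend on the truncation [L]: this leaves the freedom of
    majorizing by polynomials of growing degree. *)
Lemma ddnorm_le f B :
  (forall L, exists2 W : nat -> R,
    (forall n a, (n < L)%N -> modc (cderivn n f a) <= W n) &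
    \sum_(n < L) W n / M n <= B) -> (ddnorm M f <= B%:E)%E.
Proof.
move=> fW; apply: lime_le.
  by apply: is_cvg_nneseries => n _ _; exact: ddnorm_term_ge0.
near=> L; have [W WP WB] := fW L.
apply: le_trans (_ : _ <= (\sum_(n < L) W n / M n)%:E)%E _; last by rewrite lee_fin.
rewrite big_mkord -sumEFin; apply: lee_sum => n _.
rewrite EFinM; apply: lee_wpmul2r; first by rewrite lee_fin invr_ge0 ltW// weightSeq_gt0.
by apply: supnorm_le => a; rewrite lee_fin; exact: WP.
Unshelve. all: by end_near. Qed.

End SupNorms.

Section AnalyticMaps.
Context {R : realType}.

Lemma analytic_bound (X : planeSet R) (f : X -> R[i]) : analytic f ->
  exists2 C : R, 1 <= C & forall k a, (0 < k)%N -> modc (cderivn k f a) <= k`!%:R * C ^+ k.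
Proof.
move=> [_]; set s := ereal_sup _ => sy.
have term k a : (0 < k)%N -> exists2 r, modc (cderivn k f a) / k`!%:R <= r &
    0 <= r /\ ((r `^ k%:R^-1)%:E <= s)%E.
  move=> k0; have k0' : k%:R^-1 != 0 :> R by rewrite invr_eq0 pnatr_eq0 -lt0n.
  have kf0 : 0 < k`!%:R^-1 :> R by rewrite invr_gt0 ltr0n fact_gt0.
  set x := (supnorm (cderivn k f) * (k`!%:R^-1)%:E)%E.
  have xs : (x `^ k%:R^-1 <= s)%E by apply: ereal_sup_ubound; exists k.
  have x0 : (0 <= x)%E by rewrite mule_ge0 ?supnorm_ge0// lee_fin ltW.
  have xfin : x \is a fin_num.
    by rewrite ge0_fin_numE//; apply: (lty_poweRy k0'); exact: le_lt_trans xs sy.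
  exists (fine x); last first.
    by split; [exact: fine_ge0|rewrite -poweR_EFin fineK].
  rewrite -lee_fin fineK// EFinM; apply: lee_wpmul2r; first by rewrite lee_fin ltW.
  exact: supnorm_ub.
have s0 : (0 <= s)%E.
  have [x /mem_set Xx] := planeSet_neq0 X.
  have [r _ [_ rs]] := term 1%N (exist _ x Xx) isT.
  by apply: le_trans rs; rewrite lee_fin powR_ge0.
have sfin : s \is a fin_num by rewrite ge0_fin_numE.
exists (Num.max 1 (fine s)) => [|k a k0]; first by rewrite le_max lexx.
have [r fr [r0 rs]] := term k a k0.
have kf0 : 0 < k`!%:R :> R by rewrite ltr0n fact_gt0.
rewrite mulrC -ler_pdivrMr//; apply: le_trans fr _.
have k0' : k%:R != 0 :> R by rewrite pnatr_eq0 -lt0n.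
have -> : r = (r `^ k%:R^-1) ^+ k.
  by rewrite -powR_mulrn ?powR_ge0// -powRrM mulVf// powRr1.
have max0 : 0 <= Num.max 1 (fine s) by rewrite le_max ler01.
rewrite lerXn2r ?nnegrE ?powR_ge0//.
rewrite -lee_fin; apply: (le_trans rs).
by rewrite -[X in (X <= _)%E](fineK sfin) lee_fin le_max lexx orbT.
Qed.

(** The pointwise alternative is an open condition, so on the compact disc it
    holds with a uniform margin. *)
Lemma uniform_gap (phi : closed_disc R -> closed_disc R) :
  Dinfty (set_val \o phi) ->
  (forall a, modc (set_val (phi a)) < 1 \/ modc (cderiv (set_val \o phi) a) < 1) ->
  exists2 d : R, 0 < d <= 1 & forall a, modc (set_val (phi a)) <= 1 - d \/
    modc (cderiv (set_val \o phi) a) <= 1 - d.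
Proof.
move=> phiD phi1.
have near_modc (g : closed_disc R -> R[i]) a l : has_cderiv g a l -> modc (g a) < 1 ->
    exists2 d : R, 0 < d & \forall c \near (0 : R)^'+, forall z,
      modc (set_val z - set_val a) < d -> modc (g z) <= 1 - c.
  move=> /has_cderiv_continuous gc ga1.
  have h0 : 0 < (1 - modc (g a)) / 2 by rewrite divr_gt0// subr_gt0.
  have /cvg_modcP/(_ _ h0)[d d0 dP] := gc.
  exists d => //; have : \forall c \near (0 : R)^'+, c < (1 - modc (g a)) / 2 by exact: nbhs_right_lt.
  apply: filterS => c ch z /dP zd.
  have := lerB_modc (g z) (g a); lra.
have : \forall c \near (0 : R)^'+, forall a, modc (set_val (phi a)) <= 1 - c \/
    modc (cderiv (set_val \o phi) a) <= 1 - c.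
  apply: disc_compactness => a; have [a1|a1] := phi1 a.
    have [d d0 dP] := near_modc (set_val \o phi) a _ (phiD 0%N a) a1.
    by exists d => //; apply: filterS dP => c cP z /cP; left.
  have [d d0 dP] := near_modc (cderiv (set_val \o phi)) a _ (phiD 1%N a) a1.
  by exists d => //; apply: filterS dP => c cP z /cP; right.
move=> near_gap.
have near01 : \forall c \near (0 : R)^'+, 0 < c <= 1.
  near=> c; apply/andP; split; near: c; first exact: nbhs_right_gt.
  exact: nbhs_right_le.
by have [d [? ?]] := filter_ex (filterI near01 near_gap); exists d.
Unshelve. all: by end_near. Qed.

End AnalyticMaps.

(** * Compactness of the composition operator *)

Section UltraLimits.
Context {R : realType} {T : Type} {F : set_system T}.
Implicit Types (u : T -> R[i]) (l : R[i]) (B : R).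

(** Scaled into the compact unit disc, the values have a cluster point, to which
    an ultrafilter converges. *)
Lemma ultra_cvg_bounded (UF : UltraFilter F) u B : 0 <= B ->
  (\forall y \near F, modc (u y) <= B) -> exists l, u y @[y --> F] --> l.
Proof.
move=> B0 uB; have B1 : 0 < B + 1 by rewrite ltr_wpDl.
have B1c : (B + 1)%:C%C != 0 :> R[i] by rewrite -modc_gt0 modc_real gtr0_norm.
pose v y := u y / (B + 1)%:C%C.
have vD : (v @ F) disc_set.
  apply: filterS uB => y uB; rewrite /= disc_setE /v modcM modcV modc_real gtr0_norm//.
  by rewrite ler_pdivrMr// mul1r; apply: le_trans uB _; rewrite lerDl.
have PF : ProperFilter F by exact: ultra_proper.
have [p [_ vp]] := @disc_set_compact R _ (fmap_proper_filter v PF) vD.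
have vlim : v y @[y --> F] --> p.
  move=> U Up; have [//|FU] := in_ultra_setVsetC (v @^-1` U) _.
  by have [x [xU Ux]] := vp (~` U) U FU Up.
exists ((B + 1)%:C%C * p).
have -> : u = fun y => (B + 1)%:C%C * v y.
  by apply/funext => y; rewrite /v mulrC divfK.
by apply: cvgcM; [exact: cvg_cst|exact: vlim].
Qed.

Lemma modc_lim_le {FF : ProperFilter F} u l B : u y @[y --> F] --> l ->
  (\forall y \near F, modc (u y) <= B) -> modc l <= B.
Proof.
move=> /cvg_modcP ul uB; apply/ler_addgt0Pr => e e0.
have [y [ule uyB]] := filter_ex (filterI (ul e e0) uB).
have -> : l = u y - (u y - l) by ring.
by apply: le_trans (modcD _ _) _; rewrite modcN lerD// ltW.
Qed.

End UltraLimits.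

Lemma expr_small {R : realType} (rho c e : R) : 0 <= rho < 1 -> 0 <= c -> 0 < e ->
  exists N, c * rho ^+ N <= e.
Proof.
move=> /andP[r0 r1] c0 e0.
have c1 : 0 < c + 1 by rewrite ltr_wpDl.
have : rho ^+ n @[n --> \oo] --> (0 : R) by apply: cvg_expr; rewrite ger0_norm.
move=> /cvgrPdist_lt/(_ _ (divr_gt0 e0 c1))[N _ /(_ N (leqnn _))].
rewrite sub0r normrN ger0_norm ?exprn_ge0// ltr_pdivlMr// => rN.
exists N; apply: le_trans (ltW rN); rewrite mulrC ler_wpM2l ?exprn_ge0//.
by rewrite lerDl.
Qed.

Section Compactness.
Context {R : realType} (M : weightSeq R).
Notation disc := (closed_disc R).
Variables (phi : disc -> disc) (K rho : R).
Hypotheses (phiD : Dinfty (set_val \o phi)) (K0 : 0 <= K) (rho01 : 0 <= rho < 1).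
Hypothesis est : forall (f : disc -> R[i]) (S : nat -> R) L, Dinfty f ->
  (forall m a, modc (cderivn m f a) <= S m) ->
  exists2 W : nat -> R,
    (forall n a, (n < L)%N -> modc (cderivn n (f \o phi) a) <= W n) &
    \sum_(n < L) W n / M n <= K * \sum_(m < L.+1) rho ^+ m * (S m / M m).

Let M0 n : 0 < M n. Proof. exact: weightSeq_gt0. Qed.

Let rhoX m : 0 <= rho ^+ m <= 1.
Proof. by have /andP[r0 r1] := rho01; rewrite exprn_ge0//= exprn_ile1// ltW. Qed.

Lemma estimate_induces : induces_endomorphism M phi.
Proof.
move=> f /asboolP[fD nf]; apply/asboolP; split; first exact: Dinfty_comp.
apply: le_lt_trans (_ : _ <= (K * fine (ddnorm M f))%:E)%E (ltry _).
apply: ddnorm_le => L.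
have [W WP WB] := est L fD (fun m a => dsup_ub m a nf).
exists W => //; apply: le_trans WB _; apply: ler_wpM2l => //.
apply: le_trans (sum_dsup_le L.+1 nf); apply: ler_sum => m _.
by have /andP[_ r1] := rhoX m; rewrite -[leRHS]mul1r ler_wpM2r// divr_ge0 ?dsup_ge0 ?ltW.
Qed.

Variable phiE : induces_endomorphism M phi.

Let Dal := dalesDavie disc M.
Let T : Dal -> Dal := induced_endomorphism phiE.

Definition dd_ball (r : R) : set Dal := [set f | fine (ddnorm M f) <= r].

Lemma dd_fin (f : Dal) : (ddnorm M f < +oo)%E.
Proof. by have /asboolP[] := dalesDavieP f. Qed.

Lemma dd_Dinfty (f : Dal) : Dinfty f.
Proof. by have /asboolP[] := dalesDavieP f. Qed.

Lemma dd_ball_dsup r (f : Dal) m : dd_ball r f -> dsup m f <= r * M m.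
Proof.
move=> fr; rewrite -ler_pdivrMr//; apply: le_trans fr.
apply: le_trans (sum_dsup_le m.+1 (dd_fin f)).
by rewrite big_ord_recr /= lerDr sumr_ge0// => i _; rewrite divr_ge0 ?dsup_ge0 ?ltW.
Qed.

Lemma dd_ball_deriv r (f : Dal) m a : dd_ball r f -> modc (cderivn m f a) <= r * M m.
Proof. by move=> fr; apply: le_trans (dd_ball_dsup m fr); exact: dsup_ub (dd_fin f). Qed.

Section UltraLimitFunction.
Variables (I : Type) (F : set_system I) (UF : UltraFilter F) (s : I -> Dal) (r : R).
Hypothesis (sr : \forall y \near F, dd_ball r (s y)).
Variable g : nat -> disc -> R[i].
Hypothesis (gP : forall m a, cderivn m (s y) a @[y --> F] --> g m a).

Let r0 : 0 <= r.
Proof.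
have [y sy] := filter_ex sr; apply: le_trans sy.
by rewrite fine_ge0// ddnorm_ge0.
Qed.

Let rM0 m : 0 <= r * M m. Proof. by rewrite mulr_ge0// ltW. Qed.

(** The quadratic remainder estimate is uniform on the ball, hence passes to the
    pointwise limit and exhibits its derivative. *)
Lemma limit_has_cderiv m a : has_cderiv (g m) a (g m.+1 a).
Proof.
have quad z : modc (g m z - g m a - g m.+1 a * (set_val z - set_val a)) <=
    r * M m.+2 * modc (set_val z - set_val a) ^+ 2.
  have lim_quad : cderivn m (s y) z + (-1) * cderivn m (s y) a +
      (-1) * (cderivn m.+1 (s y) a * (set_val z - set_val a)) @[y --> F] -->
      g m z + (-1) * g m a + (-1) * (g m.+1 a * (set_val z - set_val a)).
    apply: cvgcD; first by apply: cvgcD; [exact: gP|apply: cvgcM; [exact: cvg_cst|exact: gP]].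
    by apply: cvgcM; [exact: cvg_cst|apply: cvgcM; [exact: gP|exact: cvg_cst]].
  have -> : g m z - g m a - g m.+1 a * (set_val z - set_val a) =
      g m z + (-1) * g m a + (-1) * (g m.+1 a * (set_val z - set_val a)) by ring.
  apply: (modc_lim_le lim_quad).
  apply: filterS sr => y sy; rewrite !mulN1r.
  apply: quadratic_remainder; first exact/Dinfty_cderivn/dd_Dinfty.
  by move=> b; exact: (dd_ball_deriv m.+2 b sy).
apply/has_cderivP => e e0.
have L0 : 0 < r * M m.+2 + 1 by rewrite ltr_wpDl.
exists (e / (r * M m.+2 + 1)); first by rewrite divr_gt0.
move=> z; rewrite ltr_pdivlMr// => zd.
apply: le_trans (quad z) _; rewrite expr2 mulrA ler_wpM2r ?modc_ge0//.
apply: le_trans (ltW zd); rewrite mulrC ler_wpM2l ?modc_ge0//.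
by rewrite lerDl.
Qed.

Let limit_Dinfty : Dinfty (g 0%N).
Proof. by have [] := Dinfty_seq limit_has_cderiv. Qed.

Let limit_cderivn n : cderivn n (g 0%N) = g n.
Proof. by have [_ ->] := Dinfty_seq limit_has_cderiv. Qed.

Let limit_bound m a : modc (g m a) <= r * M m.
Proof.
have lim_ga : cderivn m (s y) a @[y --> F] --> g m a by exact: gP.
apply: (modc_lim_le lim_ga); apply: filterS sr => y sy; exact: dd_ball_deriv.
Qed.

(** Pointwise convergence is uniform, because the functions involved share a
    Lipschitz constant and the disc is compact. *)
Lemma limit_uniform m (e : R) : 0 < e ->
  \forall y \near F, forall z, modc (cderivn m (s y) z - g m z) <= e.
Proof.
move=> e0; set L := r * M m.+1.
have L1 : 0 < L + 1 by rewrite ltr_wpDl// rM0.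
have lip (f : disc -> R[i]) z a : Dinfty f -> (forall b, modc (cderiv f b) <= L) ->
    modc (f z - f a) <= L * modc (set_val z - set_val a).
  by move=> fD fL; apply: mean_value_disc => //; exact: (fD 0%N).
have lip_g z a : modc (g m z - g m a) <= L * modc (set_val z - set_val a).
  rewrite -limit_cderivn; apply: lip; first exact: Dinfty_cderivn.
  by move=> b; rewrite -[cderiv _]/(cderivn m.+1 (g 0%N)) limit_cderivn; exact: limit_bound.
have e3 : 0 < e / 3 by rewrite divr_gt0.
apply: disc_compactness => a; exists (e / 3 / (L + 1)); first by rewrite divr_gt0.
have /cvg_modcP/(_ _ e3) near_a := @gP m a.
apply: filterS (filterI sr near_a) => y [sy ya] z; rewrite ltr_pdivlMr// => zd.
have lip_f : modc (cderivn m (s y) z - cderivn m (s y) a) <= L * modc (set_val z - set_val a).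
  apply: lip; first exact/Dinfty_cderivn/dd_Dinfty.
  by move=> b; exact: (dd_ball_deriv m.+1 b sy).
have Ld : L * modc (set_val z - set_val a) <= e / 3.
  apply: le_trans (ltW zd); rewrite mulrC ler_wpM2l ?modc_ge0//.
  by rewrite lerDl.
have -> : cderivn m (s y) z - g m z = (cderivn m (s y) z - cderivn m (s y) a) +
    (cderivn m (s y) a - g m a) - (g m z - g m a) by ring.
apply: le_trans (modcD _ _) _; rewrite modcN.
apply: le_trans (lerD (modcD _ _) (lexx _)) _.
have := le_trans lip_f Ld; have := le_trans (lip_g z a) Ld; lra.
Qed.

Let near_all (P : nat -> I -> Prop) N : (forall m, \forall y \near F, P m y) ->
  \forall y \near F, forall m, (m < N)%N -> P m y.
Proof.
move=> PF; elim: N => [|N IHN]; first by apply: filterS sr => y _ [].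
apply: filterS (filterI IHN (PF N)) => y [yN Ny] m.
by rewrite ltnS leq_eqVlt => /orP[/eqP ->|/yN].
Qed.

(** By uniform convergence each partial sum of the norm of the limit is
    approximated by that of a member of the ball. *)
Lemma limit_ddnorm : (ddnorm M (g 0%N) <= r%:E)%E.
Proof.
apply/lee_addgt0Pr => e e0; rewrite -EFinD; apply: ddnorm_le => L.
set c := \sum_(n < L) (M n)^-1.
have c0 : 0 <= c by apply: sumr_ge0 => n _; rewrite invr_ge0 ltW.
have c1 : 0 < c + 1 by rewrite ltr_wpDl.
pose e' := e / (c + 1); have e'0 : 0 < e' by rewrite divr_gt0.
have [y [sy yL]] := filter_ex (filterI sr (near_all L (fun m => limit_uniform m e'0))).
exists (fun n => dsup n (s y) + e') => [n a nL|].
  rewrite limit_cderivn.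
  have -> : g n a = cderivn n (s y) a - (cderivn n (s y) a - g n a) by ring.
  apply: le_trans (modcD _ _) _; rewrite modcN.
  by apply: lerD; [exact: dsup_ub (dd_fin _)|exact: yL].
under eq_bigr do rewrite mulrDl.
rewrite big_split /= -mulr_sumr -/c; apply: lerD.
  exact: le_trans (sum_dsup_le L (dd_fin _)) sy.
by rewrite /e' mulrAC ler_pdivrMr// ler_pM2l// lerDl.
Qed.

Lemma limit_in_dd : g 0%N \in ddmem disc M.
Proof. by apply/asboolP; split => //; exact: le_lt_trans limit_ddnorm (ltry _). Qed.

Let G : Dal := DalesDavie limit_in_dd.

Lemma limit_in_ball : dd_ball r G.
Proof.
rewrite /dd_ball /= -lee_fin fineK; first exact: limit_ddnorm.
by rewrite ge0_fin_numE ?ddnorm_ge0//; exact: dd_fin G.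
Qed.

(** In the image the finitely many derivatives that matter converge uniformly,
    and the damping factors make the remaining ones small. *)
Lemma limit_image (e : R) : 0 < e ->
  \forall y \near F, fine (ddnorm M (T (G - s y))) <= e.
Proof.
move=> e0.
have r1 : 0 < 1 - rho by rewrite subr_gt0; case/andP: rho01.
have e2 : 0 < e / 2 by rewrite divr_gt0.
have KR0 : 0 <= K * (2 * r / (1 - rho)) by rewrite mulr_ge0// divr_ge0 ?(ltW r1)// mulr_ge0.
have [N tailN] := expr_small rho01 KR0 e2.
set c := \sum_(n < N) (M n)^-1.
have c0 : 0 <= c by apply: sumr_ge0 => n _; rewrite invr_ge0 ltW.
have Kc1 : 0 < K * c + 1 by rewrite ltr_wpDl// mulr_ge0.
pose e' := e / 2 / (K * c + 1); have e'0 : 0 < e' by rewrite divr_gt0.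
apply: filterS (filterI sr (near_all N (fun m => limit_uniform m e'0))) => y [sy yN].
have GE : dalesDavie_fun (G - s y) = (-1) *: dalesDavie_fun (s y) + g 0%N.
  by apply/funext => a; rewrite [LHS]addrC; congr (_ + _); rewrite scaleN1r.
have dE m a : cderivn m (G - s y) a = g m a - cderivn m (s y) a.
  rewrite GE (cderivnP _ _ (@dd_Dinfty (s y)) limit_Dinfty).
  by rewrite limit_cderivn addrC scaleN1r.
pose S m := if (m < N)%N then e' else 2 * r * M m.
have S0 m : 0 <= S m by rewrite /S; case: ifP => _; [exact: ltW|rewrite -mulrA mulr_ge0].
have dS m a : modc (cderivn m (G - s y) a) <= S m.
  rewrite dE /S; case: ifP => [mN|_]; first by rewrite modc_dist; exact: yN.
  apply: le_trans (modcD _ _) _; rewrite modcN.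
  have := limit_bound m a; have := dd_ball_deriv m a sy; lra.
have dd_le : (ddnorm M (T (G - s y)%R) <= e%:E)%E.
  apply: ddnorm_le => L.
  have hD : Dinfty (G - s y) by exact: dd_Dinfty.
  have [W WP WB] := est L hD dS.
  exists W => //; apply: le_trans WB _.
  pose t m := rho ^+ m * (S m / M m).
  have t0 m : 0 <= t m.
    by have /andP[? _] := rhoX m; rewrite mulr_ge0// divr_ge0// ltW.
  (* The first N terms are controlled by the uniform convergence, the others by
     a geometric series. *)
  have tsum : \sum_(m < L.+1) t m <= e' * c + 2 * r / (1 - rho) * rho ^+ N.
    apply: le_trans (_ : _ <= \sum_(m < N + L.+1) t m) _.
      rewrite (big_ord_widen _ t (leq_addl N L.+1)) big_mkcond.
      by apply: ler_sum => m _; case: ifP.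
    rewrite big_split_ord /=; apply: lerD.
      rewrite mulr_sumr; apply: ler_sum => m _; rewrite /t /S ltn_ord.
      have /andP[_ m1] := rhoX m; rewrite -[leRHS]mul1r ler_wpM2r//.
      by rewrite mulr_ge0 ?invr_ge0 ?ltW.
    rewrite (eq_bigr (fun j : 'I_L.+1 => 2 * r * rho ^+ N * rho ^+ j)); last first.
      move=> j _; rewrite /t /S ltnNge leq_addr /= exprD mulfK ?gt_eqF//; ring.
    rewrite -mulr_sumr [leRHS]mulrAC; apply: ler_wpM2l.
      by have /andP[? _] := rhoX N; rewrite mulr_ge0// mulr_ge0.
    rewrite -[leRHS]mul1r ler_pdivlMr//.
    have -> : (\sum_(j < L.+1) rho ^+ j) * (1 - rho) = 1 - rho ^+ L.+1.
      by rewrite -[RHS]opprB subrX1; ring.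
    by have /andP[? _] := rhoX L.+1; rewrite gerBl.
  apply: le_trans (ler_wpM2l K0 tsum) _.
  rewrite mulrDr [e in leRHS]splitr; apply: lerD; last by rewrite mulrA.
  rewrite /e' mulrCA -[leRHS]mulr1 -!mulrA ler_pM2l// ler_pM2l ?invr_gt0//.
  by rewrite mulrC ler_pdivrMr// mul1r lerDl.
have nn := ddnorm_ge0 M (T (G - s y)).
by move: dd_le; case: (ddnorm _ _) nn => //= x _; rewrite lee_fin.
Qed.

End UltraLimitFunction.

(** Along an ultrafilter all derivatives of the preimages converge pointwise;
    the limits are the derivatives of an element of the same ball. *)
Lemma compact_image_ball r : compact (T @` dd_ball r).
Proof.
rewrite compact_ultra => F UF FB.
have /choice[s sP] : forall y, exists f,
    (T @` dd_ball r) y -> dd_ball r f /\ T f = y.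
  move=> y; have [[f fr fy]|ny] := pselect ((T @` dd_ball r) y).
    by exists f.
  by exists y => /ny.
have sF : \forall y \near F, dd_ball r (s y) /\ T (s y) = y by exact: filterS sP FB.
have sr : \forall y \near F, dd_ball r (s y) by apply: filterS sF => y [].
have [y0 sy0] := filter_ex sr.
have r0 : 0 <= r by apply: le_trans sy0; rewrite fine_ge0// ddnorm_ge0.
have lims (p : nat * disc) : exists l : R[i], cderivn p.1 (s y) p.2 @[y --> F] --> l.
  apply: (ultra_cvg_bounded UF (B := r * M p.1)); first by rewrite mulr_ge0// ltW.
  by apply: filterS sr => y sy; exact: dd_ball_deriv.
have [l lP] := choice lims.
pose g m a := l (m, a).
have gP m a : cderivn m (s y) a @[y --> F] --> g m a := lP (m, a).
pose G : Dal := DalesDavie (limit_in_dd UF sr gP).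
exists (T G); split; first by exists G => //; exact: limit_in_ball.
apply/fcvgrPdist_lt => e e0.
have eE := complex_ge0 (ltW e0).
have e0' : 0 < complex.Re e by rewrite -ltcR -eE.
have := limit_image UF sr gP (divr_gt0 e0' (ltr0n R 2)).
move=> small; apply: filterS (filterI sF small) => y [[_ Ty] le_e].
rewrite eE (_ : T G - y = T (G - s y)); last first.
  by rewrite -[in LHS]Ty; exact: val_inj.
rewrite -[`|_|]/((fine (ddnorm M (T (G - s y)%R)))%:C%C) ltcR.
apply: le_lt_trans le_e _.
by rewrite ltr_pdivrMr// ltr_pMr// ltr1n.
Qed.

Lemma composition_compact : compact_operator (induced_endomorphism phiE).
Proof.
move=> B [r' [_ /(_ (r' + 1))]]; rewrite ltrDl ltr01 => /(_ isT).
set r := r' + 1 => Br.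
have BB : T @` B `<=` T @` dd_ball (complex.Re r).
  move=> _ [f Bf <-]; exists f => //; rewrite /dd_ball /=.
  have := Br f Bf; rewrite /= -[`|f|]/((fine (ddnorm M f))%:C%C).
  by case: (r) => a b; rewrite lecE /= => /andP[].
apply: precompact_subset BB _; apply: compact_precompact; first exact: norm_hausdorff.
exact: compact_image_ball.
Qed.

End Compactness.

(** * Necessity of the condition *)

Section Necessity.
Context {R : realType} (M : weightSeq R).
Notation disc := (closed_disc R).
Notation Dal := (dalesDavie disc M).

Let M0 n : 0 < M n. Proof. exact: weightSeq_gt0. Qed.

Lemma dd_cderivnB (f g : Dal) n a :
  cderivn n (f - g) a = cderivn n f a - cderivn n g a.
Proof.
have -> : dalesDavie_fun (f - g) = (-1) *: dalesDavie_fun g + dalesDavie_fun f.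
  by apply/funext => b; rewrite [LHS]addrC; congr (_ + _); rewrite scaleN1r.
by rewrite (cderivnP _ _ (dd_Dinfty (f := g)) (dd_Dinfty (f := f))) addrC scaleN1r.
Qed.

Lemma dd_cderivnZ (c : R[i]) (f : Dal) n a : cderivn n (c *: f) a = c * cderivn n f a.
Proof.
have -> : dalesDavie_fun (c *: f) = c *: dalesDavie_fun f + 0 by rewrite addr0.
by rewrite (cderivnP _ _ (dd_Dinfty (f := f)) (@Dinfty0 _ _)) cderivn0 addr0.
Qed.

Lemma dd_normZ (c : R[i]) (f : Dal) :
  fine (ddnorm M (c *: f)%R) = modc c * fine (ddnorm M f).
Proof. by apply: complexI; rewrite rmorphM; exact: dalesDavie_normZ. Qed.

Lemma dd_normB (f g : Dal) :
  fine (ddnorm M (f - g)%R) <= fine (ddnorm M f) + fine (ddnorm M g).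
Proof. by rewrite -lecR rmorphD; exact: (ler_normB f g). Qed.

Definition vanish n (w : disc) (f : disc -> R[i]) := forall i, (i < n)%N -> cderivn i f w = 0.

(** At a zero of order [n] only the leading term of the [n]-th derivative of a
    composite survives. *)
Lemma cderivn_comp_vanish (phi : disc -> disc) (z0 : disc) n (f : disc -> R[i]) :
  Dinfty (set_val \o phi) -> Dinfty f -> vanish n (phi z0) f ->
  cderivn n (f \o phi) z0 = cderivn n f (phi z0) * cderiv (set_val \o phi) z0 ^+ n.
Proof.
move=> phiD; elim/ltn_ind: n f => -[_ f _ _|n IHn f fD fn].
  by rewrite expr0 mulr1.
have f'D : Dinfty (cderiv f) by exact: (@Dinfty_cderivn _ _ 1).
have f'n : vanish n (phi z0) (cderiv f) by move=> i iN; rewrite -cderivnS fn.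
rewrite cderivn_compS// big_ord_recl /= big1 => [|k _].
  rewrite bin0 mul1r addr0 subn0 IHn// -cderivnS -mulrA; congr (_ * _).
  by rewrite -exprSr.
have kn : (n - k.+1 < n)%N by rewrite ltn_subrL /=; exact: leq_ltn_trans (ltn_ord k).
rewrite /bump /= add1n IHn; first last.
- by move=> i ik; apply: f'n; exact: leq_trans ik (ltnW kn).
- exact: f'D.
- exact: ltnW.
by rewrite f'n// !mul0r mulr0.
Qed.

Section Rotation.
Variable (u : R[i]).
Hypothesis u1 : modc u = 1.

Definition rot (z : disc) : disc := disc_pt (u * set_val z).

Lemma set_val_rot z : set_val (rot z) = u * set_val z.
Proof. by apply: disc_ptK; rewrite modcM u1 mul1r disc_modc. Qed.

Lemma cderivn_rot (f : disc -> R[i]) : Dinfty f ->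
  Dinfty (f \o rot) /\ forall n, cderivn n (f \o rot) = fun a => u ^+ n * cderivn n f (rot a).
Proof.
move=> fD; have rotD a : has_cderiv (set_val \o rot) a u.
  rewrite (_ : _ \o _ = fun z : disc => u * set_val z); last first.
    by apply/funext => z /=; exact: set_val_rot.
  by rewrite -[X in has_cderiv _ _ X]mulr1; apply: has_cderivZ; exact: has_cderiv_id.
have -> : f \o rot = (fun n a => u ^+ n * cderivn n f (rot a)) 0%N.
  by apply/funext => a /=; rewrite mul1r.
apply: Dinfty_seq => n a.
rewrite exprSr -mulrA [u * _]mulrC; apply: has_cderivZ.
by apply: (has_cderiv_comp (f := cderivn n f) _ (rotD a)); exact: fD.
Qed.

(** Rotations preserve the modulus of every derivative. *)
Lemma rot_in_dd (f : Dal) : (f : disc -> R[i]) \o rot \in ddmem disc M /\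
  (ddnorm M (dalesDavie_fun f \o rot) <= (fine (ddnorm M f))%:E)%E.
Proof.
have [frD frE] := cderivn_rot (dd_Dinfty (f := f)).
have le_f : (ddnorm M (dalesDavie_fun f \o rot) <= (fine (ddnorm M f))%:E)%E.
  apply: ddnorm_le => L; exists (fun n => dsup n f).
    by move=> n a _; rewrite frE modcM modcX u1 expr1n mul1r; exact: dsup_ub (dd_fin f).
  exact: sum_dsup_le (dd_fin f).
by split=> //; apply/asboolP; split; [exact: frD|exact: le_lt_trans le_f (ltry _)].
Qed.

End Rotation.

Section Extremal.
Variables (w : disc) (n : nat).

Let q (k : nat) (z : disc) : R[i] := (n ^_ k)%:R * (set_val z - set_val w) ^+ (n - k).

Let q_deriv k a : has_cderiv (q k) a (q k.+1 a).
Proof.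
rewrite /q ffactnSr natrM -mulrA subnS -[(_ : R[i]) ^+ (n - k).-1]mulr1 mulrA mulrA.
rewrite -[_ * 1]mulrA -!mulrA; apply: has_cderivZ; rewrite mulrA -[X in _ * X]subr0.
by apply: has_cderivX; apply: has_cderivB; [exact: has_cderiv_id|exact: has_cderiv_cst].
Qed.

Lemma power_in_dd : q 0%N \in ddmem disc M.
Proof.
have [qD qE] := Dinfty_seq q_deriv; apply/asboolP; split => //.
pose W k : R := (n ^_ k)%:R * 2 ^+ (n - k).
have W0 k : 0 <= W k / M k by rewrite divr_ge0 ?mulr_ge0// ltW.
apply: le_lt_trans (_ : _ <= (\sum_(k < n.+1) W k / M k)%:E)%E (ltry _).
apply: ddnorm_le => L; exists W => [k a _|].
  rewrite qE /q modcM modc_nat modcX ler_wpM2l// lerXn2r ?nnegrE ?modc_ge0//.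
  apply: le_trans (modcD _ _) _; rewrite modcN.
  have := disc_modc a; have := disc_modc w; lra.
apply: le_trans (_ : _ <= \sum_(k < n.+1 + L) W k / M k) _.
  rewrite (big_ord_widen _ (fun k => W k / M k) (leq_addl n.+1 L)) big_mkcond.
  by apply: ler_sum => k _; case: ifP.
rewrite big_split_ord /= [X in _ + X]big1 ?addr0// => k _.
by rewrite /W ffact_small ?mul0r// ltn_addr.
Qed.

Let power : Dal := DalesDavie power_in_dd.

Let power_vanish : vanish n w power.
Proof.
have [_ qE] := Dinfty_seq q_deriv.
by move=> i iN; rewrite qE /q subrr expr0n subn_eq0 leqNgt iN mulr0.
Qed.

Let power_deriv : cderivn n power w = n`!%:R.
Proof.
have [_ qE] := Dinfty_seq q_deriv.
by rewrite qE /q subnn mulr1 ffactnn.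
Qed.

(** Their supremum is the norm of the [n]-th derivative at [w], as a functional
    on the functions of the algebra vanishing to order [n] there. *)
Let vals : set R := [set modc (cderivn n f w) | f in [set f : Dal |
  vanish n w f /\ fine (ddnorm M f) <= 1]].

(** A function that almost attains this norm; that the norm is not zero is
    shown by a power of [z - w]. *)
Lemma extremal : exists2 f : Dal, vanish n w f /\ fine (ddnorm M f) <= 1 &
  0 < modc (cderivn n f w) /\
  forall g : Dal, vanish n w g ->
    modc (cderivn n g w) <= 2 * modc (cderivn n f w) * fine (ddnorm M g).
Proof.
have dd0 (g : Dal) : 0 <= fine (ddnorm M g) by rewrite fine_ge0// ddnorm_ge0.
have normalize (g : Dal) (t : R) : vanish n w g -> 0 < t -> fine (ddnorm M g) <= t ->
    vals (t^-1 * modc (cderivn n g w)).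
  move=> gn t0 gt; exists (t^-1%:C%C *: g) => /=; last first.
    by rewrite dd_cderivnZ modcM modc_real ger0_norm// invr_ge0 ltW.
  split=> [i iN|]; first by rewrite dd_cderivnZ gn// mulr0.
  rewrite dd_normZ modc_real ger0_norm ?invr_ge0 ?(ltW t0)//.
  by rewrite ler_pdivrMl// mulr1.
have p0 : 0 < fine (ddnorm M power) + 1 by rewrite ltr_wpDl.
have vp : vals ((fine (ddnorm M power) + 1)^-1 * n`!%:R).
  rewrite -(modc_nat (R := R)) -power_deriv; apply: normalize => //.
  by rewrite lerDl.
have supv : has_sup vals.
  split; first by eexists; exact: vp.
  exists (1 * M n) => _ [f [_ f1] <-]; exact: (dd_ball_deriv n w f1).
have s0 : 0 < sup vals.
  apply: lt_le_trans (ub_le_sup _ vp); last by case: supv.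
  by rewrite mulr_gt0 ?invr_gt0// ltr0n fact_gt0.
have [_ [f [fn f1] <-] sf] := sup_adherent (divr_gt0 s0 (ltr0n R 2)) supv.
have s2f : sup vals <= 2 * modc (cderivn n f w) by lra.
exists f => //; split; first by lra.
move=> g gn; have [g0|g0] := eqVneq (fine (ddnorm M g)) 0.
  have := dd_ball_deriv (M := M) (f := g) (r := 0) n w; rewrite mul0r.
  rewrite /dd_ball /= g0 lexx => /(_ isT) /le_trans; apply.
  by rewrite mulr0.
have {}g0 : 0 < fine (ddnorm M g) by rewrite lt_def g0 dd0.
have := ub_le_sup (proj2 supv) (normalize g _ gn g0 (lexx _)).
rewrite ler_pdivrMl// mulrC => /le_trans; apply.
by rewrite ler_wpM2r.
Qed.

End Extremal.

(** If the image of the unit ball were relatively compact while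
    [|phi' z0| >= 1] at a boundary point sent to the boundary, the almost
    extremal functions of all orders at [phi z0] would have images at mutual
    distance at least 1/2. *)
Lemma boundary_derivative_lt1 (phi : disc -> disc) (z0 : disc)
    (phiE : induces_endomorphism M phi) :
  Dinfty (set_val \o phi) -> compact_operator (induced_endomorphism phiE) ->
  modc (set_val z0) = 1 -> modc (set_val (phi z0)) = 1 ->
  modc (cderiv (set_val \o phi) z0) < 1.
Proof.
move=> phiD Tcpt z01 w01; rewrite ltNge; apply/negP => c1.
set c := cderiv _ z0 in c1; set w := phi z0 in w01.
pose T := induced_endomorphism phiE.
have exf n : exists f : Dal, [/\ vanish n w f, fine (ddnorm M f) <= 1,
    0 < modc (cderivn n f w) & forall g : Dal, vanish n w g ->
    modc (cderivn n g w) <= 2 * modc (cderivn n f w) * fine (ddnorm M g)].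
  by have [f [? ?] [? ?]] := extremal w n; exists f.
have [f fP] := choice exf.
pose u := set_val z0 / set_val w.
have w0 : set_val w != 0 by rewrite -modc_gt0 w01.
have u1 : modc u = 1 by rewrite modcM modcV z01 w01 invr1 mulr1.
have rotw : rot u w = z0 by apply: set_val_inj; rewrite set_val_rot// divfK.
have sep n m : (n < m)%N -> 1 / 2 <= fine (ddnorm M (T (f n) - T (f m))).
  move=> nm; have [fn _ fn0 fnext] := fP n; have [fm _ _ _] := fP m.
  (* The rotation carries h from z0 to w, where extremality is available. *)
  pose h := T (f n) - T (f m).
  have hE : dalesDavie_fun h = dalesDavie_fun (f n - f m) \o phi by [].
  have vfnm : vanish n w (f n - f m).
    move=> i iN; rewrite dd_cderivnB fn// fm ?subr0//; exact: ltn_trans nm.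
  have hd i : (i <= n)%N -> cderivn i h z0 = cderivn i (f n - f m) w * c ^+ i.
    move=> iN; have dD : Dinfty (f n - f m) by exact: dd_Dinfty.
    rewrite hE; apply: (cderivn_comp_vanish phiD dD).
    by move=> j ji; apply: vfnm; exact: leq_trans ji iN.
  have [gD gle] := rot_in_dd u1 h.
  pose g : Dal := DalesDavie gD.
  have [_ gE] := cderivn_rot u1 (dd_Dinfty (f := h)).
  have gd i : cderivn i g w = u ^+ i * cderivn i h z0 by rewrite /g /= gE rotw.
  have vg : vanish n w g.
    by move=> i iN; rewrite gd hd ?(ltnW iN)// vfnm// mul0r mulr0.
  have := fnext g vg; rewrite gd modcM modcX u1 expr1n mul1r hd// modcM modcX.
  rewrite dd_cderivnB [X in _ - X]fm// subr0 => ext.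
  have cn1 : 1 <= modc c ^+ n by exact: exprn_ege1.
  have gh : fine (ddnorm M g) <= fine (ddnorm M h).
    by rewrite -lee_fin fineK// ge0_fin_numE ?ddnorm_ge0//; exact: (dd_fin g).
  have : modc (cderivn n (f n) w) * 1 <=
      modc (cderivn n (f n) w) * (2 * fine (ddnorm M h)).
    apply: le_trans (_ : _ <= modc (cderivn n (f n) w) * modc c ^+ n) _.
      by rewrite ler_wpM2l// modc_ge0.
    apply: le_trans ext _; rewrite [2 * _]mulrC -mulrA.
    by rewrite ler_wpM2l ?modc_ge0// ler_wpM2l.
  by rewrite ler_pM2l//; rewrite -/h; lra.
pose B : set Dal := [set f | fine (ddnorm M f) <= 1].
have bB : bounded_set B.
  exists 1; split=> // x x1 g Bg; apply: le_trans (ltW x1).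
  by rewrite -[`|g|]/((fine (ddnorm M g))%:C%C) -[1]/(1%:C%C) lecR.
have := Tcpt _ bB; rewrite precompactE => Kcpt.
pose x n := T (f n).
have xK : \forall n \near \oo, closure (T @` B) (x n).
  apply: nearW => n; apply: subset_closure; exists (f n) => //.
  by have [] := fP n.
have [p [_ px]] := Kcpt (x @ \oo) _ xK.
have nbhs_p : nbhs p (ball p (1 / 4)%:C%C) by apply: nbhsx_ballx; rewrite ltcR; lra.
have near_p N : exists2 n, (N <= n)%N & fine (ddnorm M (p - x n)) < 1 / 4.
  have : \forall n \near \oo, [set x n | n in [set n | (N <= n)%N]] (x n).
    by exists N => // n Nn; exists n.
  move=> /px /(_ nbhs_p)[_ [[n Nn <-]]]; rewrite -ball_normE /= => pn.
  by exists n => //; rewrite -ltcR.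
have [n _ pn] := near_p 0%N; have [m nm pm] := near_p n.+1.
have := sep n m nm; rewrite leNgt => /negP; apply.
have -> : T (f n) - T (f m) = (p - x m) - (p - x n).
  by rewrite opprB [RHS]addrC addrA subrK.
apply: le_lt_trans (dd_normB _ _) _; lra.
Qed.

(** At an interior point where the modulus of [phi] is maximal, a non-zero
    derivative would push the value out of the disc. *)
Lemma interior_derivative_eq0 (phi : disc -> disc) (z0 : disc) :
  cdifferentiable (set_val \o phi) z0 -> modc (set_val z0) < 1 ->
  modc (set_val (phi z0)) = 1 -> cderiv (set_val \o phi) z0 = 0.
Proof.
move=> phid z01 w1; set c := cderiv _ _; apply/eqP/negPn/negP => c0.
have cm0 : 0 < modc c by rewrite modc_gt0.
have phid' : has_cderiv (set_val \o phi) z0 c by exact: phid.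
have /has_cderivP/(_ _ (divr_gt0 cm0 (ltr0n R 2)))[d d0 dP] := phid'.
set w := set_val (phi z0) in w1.
pose t := Num.min (d / 2) (1 - modc (set_val z0)).
have t0 : 0 < t by rewrite lt_min divr_gt0// subr_gt0.
have td : t < d by rewrite gt_min ltr_pdivrMr// ltr_pMr// ltr1n.
have tz : modc (set_val z0) + t <= 1 by rewrite -lerBrDl ge_min lexx orbT.
(* The direction in which phi moves away from the origin at full speed. *)
pose v := t%:C%C * (w * (modc c)%:C%C / c).
have mv : modc v = t.
  rewrite !modcM modcV !modc_real w1 mul1r (gtr0_norm t0) gtr0_norm//.
  by rewrite divff ?mulr1// gt_eqF.
have zE : set_val (disc_pt (set_val z0 + v)) = set_val z0 + v.
  by apply: disc_ptK; apply: le_trans (modcD _ _) _; rewrite mv.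
have := dP (disc_pt (set_val z0 + v)); rewrite zE [_ + v]addrC addrK mv => /(_ td) /=.
rewrite -/w; set w' := set_val (phi _) => err.
have cv : c * v = (t * modc c)%:C%C * w by rewrite /v rmorphM; field.
have big : 1 + t * modc c - modc c / 2 * t <= modc w'.
  have -> : w' = (w + c * v) - (- (w' - w - c * v)) by ring.
  apply: le_trans (lerB_modc _ _); rewrite modcN; apply: lerB => //.
  have -> : w + c * v = (1 + t * modc c)%:C%C * w by rewrite cv rmorphD rmorph1; ring.
  by rewrite modcM w1 mulr1 modc_real ler_norm.
have w'1 : modc w' <= 1 by exact: disc_modc.
have tc0 : 0 < t * modc c by rewrite mulr_gt0.
have := le_trans big w'1; rewrite [modc c / 2 * t]mulrC mulrA; lra.
Qed.

End Necessity.

(** * Characterization of compact endomorphisms *)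

Unset Implicit Arguments.

Theorem theorem8 (R : realType) (M : weightSeq R)
    (phi : closed_disc R -> closed_disc R)
    (hM : non_analytic M) (hphi : analytic_selfmap phi) :
  (exists phiD : induces_endomorphism M phi,
     compact_operator (induced_endomorphism phiD)) <->
  [set: closed_disc R] =
    [set z : closed_disc R | `|cderiv (set_val \o phi) z| < 1] `|`
    phi @^-1` (set_val @^-1` open_disc R).
Proof.
have phiD : Dinfty (set_val \o phi) by case: hphi.
have deriv1 z : (`|cderiv (set_val \o phi) z| < 1 :> R[i]) = (modc (cderiv (set_val \o phi) z) < 1).
  by rewrite -[1]/(1%:C%C) ltcR.
split=> [[phiE Tcpt]|cover].
  apply/seteqP; split=> // z _ /=; rewrite deriv1 open_discE.
  have [|w1] := ltP (modc (set_val (phi z))) 1; [by right|left].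
  have {}w1 : modc (set_val (phi z)) = 1 by apply/eqP; rewrite eq_le w1 disc_modc.
  have [z1|z1] := ltP (modc (set_val z)) 1.
    by rewrite (interior_derivative_eq0 (phiD 0%N z) z1 w1) modc0.
  apply: (boundary_derivative_lt1 phiD Tcpt) => //.
  by apply/eqP; rewrite eq_le z1 disc_modc.
have [C C1 phiC] := analytic_bound hphi.
have phi1 a : modc (set_val (phi a)) < 1 \/ modc (cderiv (set_val \o phi) a) < 1.
  have : [set: closed_disc R] a by [].
  by rewrite cover /= deriv1 open_discE => -[]; [right|left].
have [d d01 phid] := uniform_gap phiD phi1.
have [K [rho [K0 rho01 est]]] :=
  composition_estimate hM phiD (fun k a k0 => phiC k a k0) C1 d01 phid.
exists (estimate_induces phiD K0 rho01 est).
exact: (composition_compact K0 rho01 est).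
Qed.
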